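(* For any (positive definite) Kähler structure $(\Omega^{(\bullet,\bullet)},\kappa)$ with closed integral over a $*$-algebra $B$, and any Hermitian holomorphic module $(\mathcal{F},h_{\mathcal{F}},\overline{\partial}_{\mathcal{F}})$ with Chern connection $\nabla$, the following identities hold on $\Omega^\bullet\otimes_B\mathcal{F}$: $$\Delta_\nabla=\Delta_{\partial_{\mathcal{F}}}+\Delta_{\overline{\partial}_{\mathcal{F}}}=2\Delta_{\partial_{\mathcal{F}}}-[\Lambda_{\mathcal{F}},\mathbf{i}\nabla^2]=2\Delta_{\overline{\partial}_{\mathcal{F}}}+[\Lambda_{\mathcal{F}},\mathbf{i}\nabla^2].$$
   Context: Algebras are unital over $\mathbb{C}$; $\mathbf{i}=\sqrt{-1}$. **Calculi.** A differential calculus over $B$ is a dg-algebra $(\Omega^\bullet=\bigoplus_{k\ge0}\Omega^k,\mathrm{d})$ with $\Omega^0=B$, generated as an algebra by $a,\mathrm{d}b$ ($a,b\in B$). It has total degree $m$ if $\Omega^m\ne0$ and $\Omega^k=0$ for $k>m$. It is a $*$-calculus if $B$ is a $*$-algebra whose $*$ extends to a conjugate-linear involution of $\Omega^\bullet$ with $\mathrm{d}(\omega^* )=(\mathrm{d}\omega)^*$ and $(\omega\wedge\nu)^*=(-1)^{kl}\nu^*\wedge\omega^*$ for $\omega\in\Omega^k,\nu\in\Omega^l$. **Complex structures.** A complex structure is an $\mathbb{Z}_{\ge0}^2$-algebra grading $\Omega^\bullet=\bigoplus\Omega^{(a,b)}$ with $\Omega^k=\bigoplus_{a+b=k}\Omega^{(a,b)}$,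 $(\Omega^{(a,b)})^*=\Omega^{(b,a)}$, and $\mathrm{d}=\partial+\overline{\partial}$ with $\partial,\overline{\partial}$ of degrees $(1,0)$ and $(0,1)$. **Kähler structures.** A Kähler structure on a $*$-calculus of total degree $2n$ is a pair $(\Omega^{(\bullet,\bullet)},\kappa)$ of a complex structure and a central, real ($\kappa^*=\kappa$), closed form $\kappa\in\Omega^{(1,1)}$ such that, for $L(\omega)=\kappa\wedge\omega$, the maps $L^{n-k}:\Omega^k\to\Omega^{2n-k}$ are isomorphisms for $k=0,\dots,n-1$. Let $P^{(a,b)}=\{\alpha\in\Omega^{(a,b)}: L^{n-a-b+1}\alpha=0\}$ for $a+b\le n$; then $\Omega^\bullet=\bigoplus_{a+b\le n}\bigoplus_{0\le j\le n-a-b}L^jP^{(a,b)}$. The Hodge map $\ast$ is the linear map determined by $\ast(L^j\alpha)=(-1)^{k(k+1)/2}\mathbf{i}^{a-b}\frac{j!}{(n-j-k)!}L^{n-j-k}\alpha$ for $\alpha\in P^{(a,b)}$, $k=a+b$. The metric is $g(\omega,\nu)=\ast(\omega\wedge\ast(\nu^* ))\in B$ on forms of equal degree and $0$ on forms of different degrees. $\Lambda=\ast^{-1}L\,\ast$ is the adjoint of $L$ with respect to $g$. $B_{>0}$ is the set of non-zero finite sums $\sum\lambda_ib_i^*b_i$, $\lambda_i>0$, $b_i\in B$. The structure is positive definite if $g(\omega,\omega)\in B_{>0}$ for all non-zero $\omega$. **Integral.** A state is a linear map $\mathbf{f}:B\to\mathbb{C}$ with $\mathbf{f}(b^*b)>0$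 for $b\neq0$; one such state is fixed. The integral is $\int=\mathbf{f}\circ\ast:\Omega^{2n}\to\mathbb{C}$; it is closed if $\int\circ\,\mathrm{d}=0$ on $\Omega^{2n-1}$. **Modules.** A connection on a left $B$-module $\mathcal{F}$ is a linear map $\nabla:\mathcal{F}\to\Omega^1\otimes_B\mathcal{F}$ with $\nabla(bf)=\mathrm{d}b\otimes f+b\nabla f$, extended to $\Omega^\bullet\otimes_B\mathcal{F}$ by $\nabla(\omega\otimes f)=\mathrm{d}\omega\otimes f+(-1)^{|\omega|}\omega\wedge\nabla f$. A $(0,1)$-connection is a connection for $(\Omega^{(0,\bullet)},\overline{\partial})$. A holomorphic module is a finitely generated projective left $B$-module with a flat $(0,1)$-connection $\overline{\partial}_{\mathcal{F}}$. An Hermitian module is a finitely generated projective left $B$-module with a right $B$-module isomorphism $h_{\mathcal{F}}:\overline{\mathcal{F}}\to{}^\vee\mathcal{F}={}_B\mathrm{Hom}(\mathcal{F},B)$ (where $\overline{f}b=\overline{b^*f}$ and $(\phi b)(f)=\phi(f)b$) such that $h_{\mathcal{F}}(f,k):=h_{\mathcal{F}}(\overline{k})(f)$ satisfies $h_{\mathcal{F}}(f,k)=h_{\mathcal{F}}(k,f)^*$ and $h_{\mathcal{F}}(f,f)\in B_{>0}$ for $f\ne0$. An Hermitian holomorphic module carries both structures. Extend the pairing by $h_{\mathcal{F}}(\omega\otimes f,\nu\otimes k)=\omega\,h_{\mathcal{F}}(f,k)\wedge\nu^*$. The Chern connection is the unique connection $\nabla$ with $\mathrm{d}h_{\mathcal{F}}(f,k)=h_{\mathcal{F}}(\nabla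 f,1\otimes k)+h_{\mathcal{F}}(1\otimes f,\nabla k)$ whose $(0,1)$-part is $\overline{\partial}_{\mathcal{F}}$; its $(1,0)$-part is $\partial_{\mathcal{F}}$; so $\nabla=\partial_{\mathcal{F}}+\overline{\partial}_{\mathcal{F}}$ on $\Omega^\bullet\otimes_B\mathcal{F}$. **Operators.** Set $g_{\mathcal{F}}(\omega\otimes f,\nu\otimes k)=g(\omega\,h_{\mathcal{F}}(f,k),\nu)$; $\langle\cdot,\cdot\rangle_{\mathcal{F}}=\mathbf{f}\circ g_{\mathcal{F}}$ is an inner product on $\Omega^\bullet\otimes_B\mathcal{F}$, with respect to which $\partial_{\mathcal{F}},\overline{\partial}_{\mathcal{F}}$ are adjointable when the integral is closed; adjoints are denoted $\dagger$. Put $\Lambda_{\mathcal{F}}=\Lambda\otimes\mathrm{id}_{\mathcal{F}}$, $\Delta_{\partial_{\mathcal{F}}}=(\partial_{\mathcal{F}}+\partial_{\mathcal{F}}^\dagger)^2$, $\Delta_{\overline{\partial}_{\mathcal{F}}}=(\overline{\partial}_{\mathcal{F}}+\overline{\partial}_{\mathcal{F}}^\dagger)^2$, $\Delta_\nabla=\nabla\nabla^\dagger+\nabla^\dagger\nabla$ with $\nabla^\dagger=\partial_{\mathcal{F}}^\dagger+\overline{\partial}_{\mathcal{F}}^\dagger$. Brackets are commutators. *)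

(* Defs.v *)
From HB Require Import structures.
From mathcomp Require Import all_boot all_order all_algebra.
From mathcomp Require Import complex.
From mathcomp Require Import boolp classical_sets functions cardinality.
From mathcomp Require Import fsbigop reals.

Set Implicit Arguments.
Unset Strict Implicit.
Unset Printing Implicit Defensive.

Import Order.TTheory GRing.Theory Num.Theory.

Local Open Scope classical_set_scope.
Local Open Scope ring_scope.
Local Open Scope quotient_scope.

(* The complex numbers are R[i] for R : realType.  In the order of R[i],
   0 < z means that z is real and positive. *)

Section DirectSum.
Variables (K : nzRingType) (V : lmodType K) (I : choiceType).
Implicit Types (G : I -> set V) (v : V).

Definition subspace (A : set V) : Prop :=
  A 0 /\ forall c u v, A u -> A v -> A (c *: u + v).

Definition decomposition G v : set (I -> V) :=
  [set u | [/\ forall i, G i (u i),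
               finite_set [set i | u i != 0]
             & v = \sum_(i \in [set: I]) u i]].

Definition is_direct_sum G : Prop :=
  (forall i, subspace (G i)) /\ forall v, exists! u, decomposition G v u.

(* Junk value when is_direct_sum G fails. *)
Definition component G (i : I) v : V :=
  xget (fun=> 0) (decomposition G v) i.

End DirectSum.

Section Calculi.
Variable R : realType.
Local Notation C := R[i].

Record star_algebra (B : algType C) := StarAlgebra {
  bstar :> B -> B;
  bstar_linear : forall c a b, bstar (c *: a + b) = c^* *: bstar a + bstar b;
  bstarK : forall b, bstar (bstar b) = b;
  bstarM : forall a b, bstar (a * b) = bstar b * bstar a }.

(* B is carried by a separate type and identified with Omega^0 via incl. *)
Record calculus (B Omega : algType C) := Calculus {
  incl : {lrmorphism B -> Omega};
  form : nat -> set Omega;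
  dif : {linear Omega -> Omega};
  form_direct : is_direct_sum form;
  form_mul : forall k l w v, form k w -> form l v -> form (k + l)%N (w * v);
  incl_inj : injective incl;
  form0E : form 0%N = range incl;
  form_dif : forall k w, form k w -> form k.+1 (dif w);
  dif_dif : forall w, dif (dif w) = 0;
  dif_mul : forall k w v, form k w ->
    dif (w * v) = dif w * v + (-1) ^+ k * (w * dif v);
  form_generated : forall A : set Omega,
    subspace A -> A 1 -> (forall w v, A w -> A v -> A (w * v)) ->
    (forall b, A (incl b)) -> (forall b, A (dif (incl b))) -> A = [set: Omega] }.

Variables B Omega : algType C.

Definition total_degree (cal : calculus B Omega) (m : nat) : Prop :=
  (exists2 w, form cal m w & w <> 0) /\
  forall k w, (m < k)%N -> form cal k w -> w = 0.

Record star_calculus (sB : star_algebra B) (cal : calculus B Omega) :=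
  StarCalculus {
  fstar :> Omega -> Omega;
  fstar_incl : forall b, fstar (incl cal b) = incl cal (sB b);
  fstar_linear : forall c w v, fstar (c *: w + v) = c^* *: fstar w + fstar v;
  fstarK : forall w, fstar (fstar w) = w;
  fstar_dif : forall w, dif cal (fstar w) = fstar (dif cal w);
  fstarM : forall k l w v, form cal k w -> form cal l v ->
    fstar (w * v) = (-1) ^+ (k * l)%N * (fstar v * fstar w) }.

Record complex_structure (sB : star_algebra B) (cal : calculus B Omega)
    (sC : star_calculus sB cal) := ComplexStructure {
  bform : nat -> nat -> set Omega;
  del : {linear Omega -> Omega};
  delbar : {linear Omega -> Omega};
  bform_direct : is_direct_sum (fun p : nat * nat => bform p.1 p.2);
  bform_mul : forall a b c e w v, bform a b w -> bform c e v ->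
    bform (a + c)%N (b + e)%N (w * v);
  form_bform : forall k w, form cal k w <->
    exists2 u : nat -> Omega, forall a, (a <= k)%N -> bform a (k - a)%N (u a)
                            & w = \sum_(a < k.+1) u a;
  bform_star : forall a b, [set sC w | w in bform a b] = bform b a;
  bform_del : forall a b w, bform a b w -> bform a.+1 b (del w);
  bform_delbar : forall a b w, bform a b w -> bform a b.+1 (delbar w);
  difE : forall w, dif cal w = del w + delbar w }.

Record kahler_structure (n : nat) (sB : star_algebra B)
    (cal : calculus B Omega) (sC : star_calculus sB cal) := KahlerStructure {
  kcomplex :> complex_structure sC;
  kappa : Omega;
  kappa11 : bform kcomplex 1 1 kappa;
  kappa_central : forall w, kappa * w = w * kappa;
  kappa_real : sC kappa = kappa;
  kappa_closed : dif cal kappa = 0;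
  kappa_lefschetz : forall k, (k < n)%N ->
    set_bij (form cal k) (form cal (n.*2 - k)%N)
            (iter (n - k)%N (fun w => kappa * w)) }.

Section Kahler.
Variables (n : nat) (sB : star_algebra B) (cal : calculus B Omega).
Variables (sC : star_calculus sB cal) (K : kahler_structure n sC).

Definition lefschetz (w : Omega) : Omega := kappa K * w.

Definition primitive (a b : nat) : set Omega :=
  [set w | bform K a b w /\ iter (n - (a + b)).+1 lefschetz w = 0].

Definition is_hodge (S : Omega -> Omega) : Prop :=
  linear S /\
  forall a b j w, (a + b <= n)%N -> (j <= n - (a + b))%N -> primitive a b w ->
    let k := (a + b)%N in
    S (iter j lefschetz w) =
      ((-1) ^+ (k * k.+1)./2 * 'i ^ (a%:Z - b%:Z)
         * (j`!%:R / (n - j - k)`!%:R)) *: iter (n - j - k)%N lefschetz w.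

(* is_hodge has a unique solution when cal has total degree 2n. *)
Definition hodge : Omega -> Omega := xget (@idfun Omega) is_hodge.

(* Inverse of incl on Omega^0. *)
Definition to_base (w : Omega) : B := xget 0 [set b | incl cal b = w].

Definition metric (w v : Omega) : B :=
  \sum_(k \in [set: nat])
    to_base (hodge (component (form cal) k w
                    * hodge (sC (component (form cal) k v)))).

(* The Hodge map is bijective, so this is hodge^-1 (L (hodge w)). *)
Definition dual_lefschetz (w : Omega) : Omega :=
  xget 0 [set u | hodge u = lefschetz (hodge w)].

End Kahler.

Definition positive (sB : star_algebra B) (b : B) : Prop :=
  b <> 0 /\
  exists (m : nat) (l : 'I_m -> C) (c : 'I_m -> B),
    (forall i, 0 < l i) /\ b = \sum_(i < m) l i *: (sB (c i) * c i).

Definition positive_definite (n : nat) (sB : star_algebra B)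
    (cal : calculus B Omega) (sC : star_calculus sB cal)
    (K : kahler_structure n sC) : Prop :=
  forall w, w <> 0 -> positive sB (metric K w w).

Definition is_state (sB : star_algebra B) (st : {scalar B}) : Prop :=
  forall b, b <> 0 -> 0 < st (sB b * b).

Definition closed_integral (n : nat) (sB : star_algebra B)
    (cal : calculus B Omega) (sC : star_calculus sB cal)
    (K : kahler_structure n sC) (st : {scalar B}) : Prop :=
  forall k w, k.+1 = n.*2 -> form cal k w ->
    st (to_base cal (hodge K (dif cal w))) = 0.

End Calculi.

(* Omega (x)_B F: finite formal sums of pairs, written as sequences, modulo the
   congruence generated by the tensor relations. *)
Section TensorRelation.
Variables (R : realType) (B Omega : algType R[i]) (cal : calculus B Omega).
Variable F : lmodType B.
Implicit Types s t : seq (Omega * F).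

Inductive tensor_eq : seq (Omega * F) -> seq (Omega * F) -> Prop :=
| tensor_eq_refl s : tensor_eq s s
| tensor_eq_sym s t : tensor_eq s t -> tensor_eq t s
| tensor_eq_trans s t u : tensor_eq s t -> tensor_eq t u -> tensor_eq s u
| tensor_eq_cat s s' t t' :
    tensor_eq s s' -> tensor_eq t t' -> tensor_eq (s ++ t) (s' ++ t')
| tensor_eq_comm s t : tensor_eq (s ++ t) (t ++ s)
| tensor_eq0 f : tensor_eq [:: (0, f)] [::]
| tensor_eqDl w v f : tensor_eq [:: (w + v, f)] [:: (w, f); (v, f)]
| tensor_eqDr w f g : tensor_eq [:: (w, f + g)] [:: (w, f); (w, g)]
| tensor_eqM w b f : tensor_eq [:: (w * incl cal b, f)] [:: (w, b *: f)].

Definition tensor_eqb s t : bool := `[< tensor_eq s t >].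

Lemma tensor_eqb_refl : reflexive tensor_eqb.
Proof. by move=> s; apply/asboolP; exact: tensor_eq_refl. Qed.

Lemma tensor_eqb_sym : symmetric tensor_eqb.
Proof.
by move=> s t; apply/asboolP/asboolP => st; exact: tensor_eq_sym.
Qed.

Lemma tensor_eqb_trans : transitive tensor_eqb.
Proof.
move=> t s u /asboolP st /asboolP tu; apply/asboolP.
exact: tensor_eq_trans st tu.
Qed.

Definition tensor_equiv :=
  EquivRel tensor_eqb tensor_eqb_refl tensor_eqb_sym tensor_eqb_trans.

Definition tensor := {eq_quot tensor_equiv}.

HB.instance Definition _ := Choice.on tensor.
HB.instance Definition _ := EqQuotient.on tensor.

Definition tens (w : Omega) (f : F) : tensor := \pi_tensor [:: (w, f)].

Definition balanced (V : nmodType) (phi : Omega -> F -> V) : Prop :=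
  [/\ forall w v f, phi (w + v) f = phi w f + phi v f,
      forall w f g, phi w (f + g) = phi w f + phi w g,
      forall f, phi 0 f = 0
    & forall w b f, phi (w * incl cal b) f = phi w (b *: f)].

(* The additive map with tlift phi (tens w f) = phi w f; meaningful only when
   phi is balanced, see tlift_tens and tliftD. *)
Definition tlift (V : nmodType) (phi : Omega -> F -> V) (t : tensor) : V :=
  \sum_(p <- repr t) phi p.1 p.2.

Lemma tensor_piP s t : \pi_tensor s = \pi_tensor t <-> tensor_eq s t.
Proof.
by split=> [/eqquotP/asboolP|st]; last apply/eqquotP/asboolP.
Qed.

Lemma tlift_pi (V : nmodType) (phi : Omega -> F -> V) s :
  balanced phi -> tlift phi (\pi_tensor s) = \sum_(p <- s) phi p.1 p.2.
Proof.
move=> [phiDl phiDr phi0 phiM].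
have: tensor_eq (repr (\pi_tensor s)) s by apply/tensor_piP; rewrite reprK.
rewrite /tlift; move: (repr _) => r; elim=> {r s}.
- by [].
- by move=> s t _ ->.
- by move=> s t u _ -> _ ->.
- by move=> s s' t t' _ ss' _ tt'; rewrite !big_cat /= ss' tt'.
- by move=> s t; rewrite !big_cat /= addrC.
- by move=> f; rewrite !(big_cons, big_nil) ?addr0 phi0.
- by move=> w v f; rewrite !(big_cons, big_nil) ?addr0 phiDl.
- by move=> w f g; rewrite !(big_cons, big_nil) ?addr0 phiDr.
- by move=> w b f; rewrite !(big_cons, big_nil) ?addr0 phiM.
Qed.

Lemma tlift_tens (V : nmodType) (phi : Omega -> F -> V) w f :
  balanced phi -> tlift phi (tens w f) = phi w f.
Proof. by move=> hphi; rewrite /tens tlift_pi// big_cons big_nil addr0. Qed.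

Definition tensor_add (x y : tensor) : tensor := \pi_tensor (repr x ++ repr y).
Definition tensor_scale (c : R[i]) (x : tensor) : tensor :=
  \pi_tensor [seq (c *: p.1, p.2) | p <- repr x].

Lemma tensor_pi_add s t :
  tensor_add (\pi_tensor s) (\pi_tensor t) = \pi_tensor (s ++ t).
Proof.
by apply/tensor_piP; apply: tensor_eq_cat; apply/tensor_piP; rewrite reprK.
Qed.

Lemma tensor_eq_scale c s t : tensor_eq s t ->
  tensor_eq [seq (c *: p.1, p.2) | p <- s] [seq (c *: p.1, p.2) | p <- t].
Proof.
elim=> {s t} /=.
- by move=> s; exact: tensor_eq_refl.
- by move=> s t _; exact: tensor_eq_sym.
- by move=> s t u _ st _; exact: tensor_eq_trans st.
- by move=> s s' t t' _ ss' _ tt'; rewrite !map_cat; exact: tensor_eq_cat.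
- by move=> s t; rewrite !map_cat; exact: tensor_eq_comm.
- by move=> f; rewrite scaler0; exact: tensor_eq0.
- by move=> w v f; rewrite scalerDr; exact: tensor_eqDl.
- by move=> w f g; exact: tensor_eqDr.
- by move=> w b f; rewrite scalerAl; exact: tensor_eqM.
Qed.

Lemma tensor_pi_scale c s :
  tensor_scale c (\pi_tensor s) = \pi_tensor [seq (c *: p.1, p.2) | p <- s].
Proof.
by apply/tensor_piP/tensor_eq_scale/tensor_piP; rewrite reprK.
Qed.

Lemma tensor_ind (P : tensor -> Prop) :
  (forall s, P (\pi_tensor s)) -> forall x, P x.
Proof. by move=> Ppi x; rewrite -[x]reprK. Qed.

Lemma tensor_addA : associative tensor_add.
Proof.
by do 3!elim/tensor_ind => ?; rewrite !tensor_pi_add catA.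
Qed.

Lemma tensor_addC : commutative tensor_add.
Proof.
do 2!elim/tensor_ind => ?; rewrite !tensor_pi_add.
exact/tensor_piP/tensor_eq_comm.
Qed.

Lemma tensor_add0 : left_id (\pi_tensor [::]) tensor_add.
Proof. by elim/tensor_ind => s; rewrite tensor_pi_add. Qed.

Lemma tensor_eq_scaleD c e s :
  tensor_eq [seq ((c + e) *: p.1, p.2) | p <- s]
    ([seq (c *: p.1, p.2) | p <- s] ++ [seq (e *: p.1, p.2) | p <- s]).
Proof.
apply/tensor_piP; elim: s => [//|[w f] s IHs] /=.
rewrite -cat1s -(cat1s (c *: w, f)) -(cat1s (e *: w, f)) -!tensor_pi_add IHs.
have -> : \pi_tensor [:: ((c + e) *: w, f)] =
    tensor_add (\pi_tensor [:: (c *: w, f)]) (\pi_tensor [:: (e *: w, f)]).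
  by rewrite tensor_pi_add scalerDl; exact/tensor_piP/tensor_eqDl.
rewrite -!tensor_pi_add -!tensor_addA; congr tensor_add.
by rewrite tensor_addA [tensor_add (\pi_tensor [:: _]) _]tensor_addC -tensor_addA.
Qed.

Lemma tensor_addN :
  left_inverse (\pi_tensor [::]) (tensor_scale (- 1)) tensor_add.
Proof.
elim/tensor_ind => s; rewrite tensor_pi_scale tensor_pi_add.
have [_] := tensor_piP ([seq ((-1 + 1) *: p.1, p.2) | p <- s])
  ([seq (-1 *: p.1, p.2) | p <- s] ++ [seq (1 *: p.1, p.2) | p <- s]).
move=> /(_ (tensor_eq_scaleD _ _ _)).
have -> : [seq (1 *: p.1, p.2) | p <- s] = s.
  by rewrite -[RHS]map_id; apply: eq_map => -[w f] /=; rewrite scale1r.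
move=> <-; rewrite addNr; elim: s => [//|[w f] s IHs] /=.
rewrite -cat1s -tensor_pi_add IHs -[RHS]tensor_add0; congr tensor_add.
by rewrite scale0r; exact/tensor_piP/tensor_eq0.
Qed.

HB.instance Definition _ := GRing.isZmodule.Build tensor
  tensor_addA tensor_addC tensor_add0 tensor_addN.

Lemma tensor_scaleA c e x :
  tensor_scale c (tensor_scale e x) = tensor_scale (c * e) x.
Proof.
elim/tensor_ind: x => s; rewrite !tensor_pi_scale -map_comp.
by congr (\pi_tensor _); apply: eq_map => p /=; rewrite scalerA.
Qed.

Lemma tensor_scale1 : left_id 1 tensor_scale.
Proof.
elim/tensor_ind => s; rewrite tensor_pi_scale; congr (\pi_tensor _).
by rewrite -[RHS]map_id; apply: eq_map => -[w f] /=; rewrite scale1r.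
Qed.

Lemma tensor_scaleDr : right_distributive tensor_scale +%R.
Proof.
move=> c; do 2!elim/tensor_ind => ?.
rewrite ![X in tensor_scale _ X]tensor_pi_add !tensor_pi_scale map_cat.
by rewrite -tensor_pi_add.
Qed.

Lemma tensor_scaleDl x : {morph tensor_scale^~ x : c e / c + e}.
Proof.
move=> c e; elim/tensor_ind: x => s; rewrite !tensor_pi_scale.
by rewrite [RHS]tensor_pi_add; exact/tensor_piP/tensor_eq_scaleD.
Qed.

HB.instance Definition _ := GRing.Zmodule_isLmodule.Build R[i] tensor
  tensor_scaleA tensor_scale1 tensor_scaleDr tensor_scaleDl.

Lemma tliftD (V : nmodType) (phi : Omega -> F -> V) x y :
  balanced phi -> tlift phi (x + y) = tlift phi x + tlift phi y.
Proof.
move=> hphi; elim/tensor_ind: x => s; elim/tensor_ind: y => t.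
rewrite [X in tlift _ X]tensor_pi_add !tlift_pi//.
by rewrite big_cat.
Qed.

Lemma scale_tens (c : R[i]) w f : c *: tens w f = tens (c *: w) f.
Proof. exact: tensor_pi_scale. Qed.

End TensorRelation.

Arguments tens {R B Omega} cal {F}.

Section Modules.
Variables (R : realType) (B Omega : algType R[i]) (n : nat).
Local Notation C := R[i].
Variables (sB : star_algebra B) (cal : calculus B Omega).
Variables (sC : star_calculus sB cal) (K : kahler_structure n sC).
Variables (st : {scalar B}) (F : lmodType B).
Local Notation T := (tensor cal F).

(* A direct summand of a finitely generated free left module. *)
Definition fg_projective : Prop :=
  exists (m : nat) (s : {linear F -> 'rV[B]_m}) (p : {linear 'rV[B]_m -> F}),
    forall f, p (s f) = f.

(* The image of A (x) F in Omega (x) F. *)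
Definition tensor_span (A : set Omega) : set T :=
  [set t | exists2 s : seq (Omega * F), forall p, p \in s -> A p.1
                                      & t = \sum_(p <- s) tens cal p.1 p.2].

Definition wedge (w : Omega) (t : T) : T :=
  tlift (fun v f => tens cal (w * v) f) t.

(* (Id (x) F) for a right B-linear map of forms. *)
Definition tensor_map (phi : Omega -> Omega) (t : T) : T :=
  tlift (fun w f => tens cal (phi w) f) t.

(* The grading involution, w |-> (-1)^|w| w on homogeneous forms. *)
Definition parity (w : Omega) : Omega :=
  \sum_(k \in [set: nat]) (-1) ^+ k * component (form cal) k w.

(* Connection with values in A (x) F for the differential delta, with F a
   C-module through C -> B. *)
Definition is_connection (delta : Omega -> Omega) (A : set Omega)
    (D : F -> T) : Prop :=
  [/\ forall c f g, D (c%:A *: f + g) = c *: D f + D g,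
      forall f, tensor_span A (D f)
    & forall b f, D (b *: f) = tens cal (delta (incl cal b)) f
                               + wedge (incl cal b) (D f)].

(* w (x) f |-> delta w (x) f + (-1)^|w| w /\ D f *)
Definition extension (delta : Omega -> Omega) (D : F -> T) (t : T) : T :=
  tlift (fun w f => tens cal (delta w) f + wedge (parity w) (D f)) t.

Record holomorphic_structure := HolomorphicStructure {
  dbar :> F -> T;
  dbar_connection : is_connection (delbar K) (bform K 0 1) dbar;
  dbar_flat : forall f, extension (delbar K) dbar (dbar f) = 0 }.

(* herm f k stands for h_F(conj k)(f).  The first two fields say that
   conj k |-> herm _ k is a right B-module map from the conjugate module to the
   left dual, the third that it is bijective. *)
Record hermitian_structure := HermitianStructure {
  herm :> F -> F -> B;
  herm_linearl : forall b f g k, herm (b *: f + g) k = b * herm f k + herm g k;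
  herm_linearr : forall b f g k,
    herm f (b *: g + k) = herm f g * sB b + herm f k;
  herm_bij : forall phi : {linear F -> B^o},
    exists! k, forall f, herm f k = phi f;
  herm_sym : forall f k, herm f k = sB (herm k f);
  herm_pos : forall f, f <> 0 -> positive sB (herm f f) }.

Variable h : hermitian_structure.

(* herm_ext (w (x) f, v (x) k) = w h(f, k) /\ v^* *)
Definition herm_ext (s t : T) : Omega :=
  tlift (fun w f => tlift (fun v k => w * incl cal (h f k) * sC v) t) s.

(* g_F (w (x) f, v (x) k) = g(w h(f, k), v) *)
Definition metric_tensor (s t : T) : B :=
  tlift (fun w f =>
    tlift (fun v k => metric K (w * incl cal (h f k)) v) t) s.

Definition inner (s t : T) : C := st (metric_tensor s t).

(* The adjoint with respect to inner, which is unique when it exists. *)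
Definition adjoint (A : T -> T) : T -> T :=
  xget (fun=> 0)
    [set A' : T -> T | linear A' /\ forall s t, inner (A s) t = inner s (A' t)].

Definition bidegree_part (a b : nat) : T -> T :=
  tensor_map (component (fun p : nat * nat => bform K p.1 p.2) (a, b)).

Variable hol : holomorphic_structure.

Definition is_chern_connection (nab : F -> T) : Prop :=
  [/\ is_connection (dif cal) (form cal 1) nab,
      forall f k, dif cal (incl cal (h f k)) =
        herm_ext (nab f) (tens cal 1 k) + herm_ext (tens cal 1 f) (nab k)
    & forall f, bidegree_part 0 1 (nab f) = hol f].

Variable nab : F -> T.

Definition nablaF : T -> T := extension (dif cal) nab.
Definition delF : T -> T :=
  extension (del K) (fun f => bidegree_part 1 0 (nab f)).
Definition delbarF : T -> T := extension (delbar K) hol.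

Definition delF_adj : T -> T := adjoint delF.
Definition delbarF_adj : T -> T := adjoint delbarF.
Definition nablaF_adj (t : T) : T := delF_adj t + delbarF_adj t.

Definition laplacian_del : T -> T :=
  iter 2 (fun t => delF t + delF_adj t).
Definition laplacian_delbar : T -> T :=
  iter 2 (fun t => delbarF t + delbarF_adj t).
Definition laplacian_nabla (t : T) : T :=
  nablaF (nablaF_adj t) + nablaF_adj (nablaF t).

Definition i_curvature (t : T) : T := 'i *: nablaF (nablaF t).
Definition LambdaF : T -> T := tensor_map (dual_lefschetz K).

End Modules.

Definition commutator (V : zmodType) (X Y : V -> V) (v : V) : V :=
  X (Y v) - Y (X v).

(* Main.v *)
From HB Require Import structures.
From mathcomp Require Import all_boot all_order all_algebra.
From mathcomp Require Import complex reals.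
From mathcomp Require Import boolp classical_sets functions cardinality fsbigop.
From mathcomp Require Import zify ring lra.
Require Import Defs.

(** The identities are formal consequences of the Kaehler identities, which express
    the adjoints of the two parts of the Chern connection as commutators with the
    dual Lefschetz operator:
      delF^+ = i [Lambda_F, delbarF]   and   delbarF^+ = - i [Lambda_F, delF];
    see nakano_identity for this last step.  It also uses that delF and delbarF have
    square zero.  For delbarF this is flatness; for delF it follows by taking
    adjoints (conjugate_extension_sqr).

    The Kaehler identities are first proved on forms, in a local version
    (local_kahler_identity): every linear operator D of bidegree (1, 0) that
    commutes with the Lefschetz operator L satisfies
    [Lambda, D] = - i hodge D hodge, and the conjugate identity holds in bidegree
    (0, 1).  If x is a primitive form, then D x = x0 + L v with x0 and v
    primitive, and both sides are computed on L^j x from the formula for the Hodge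
    map.  The Lefschetz decomposition (lefschetz_ind, lef_family_inj) reduces
    everything to this case; its uniqueness also gives the existence of the Hodge
    map (hodge_exists).

    Forms with values in the module F are reduced to forms by the contractions
    v (x) k |-> v h(k, f) for f in F, which separate points because F is projective
    and h is perfect (contract_inj).  Let the (0, 1)-part of the connection send f
    to the sum of the e_i (x) f_i.  Compatibility with h says that the contraction
    with f intertwines delF with del, up to multiplications by the (1, 0)-forms
    e_i^* composed with the contractions with f_i (contract_extension).
    These multiplications commute with L like del does, so the local identity
    yields [Lambda_F, delF] = - i hodge delF hodge (extension_kahler).  In the same
    way, Stokes' formula for delbar and the adjunction for multiplication by a 1-form
    show that - hodge delF hodge is the adjoint of delbarF (extension_adjoint).
    Comparing the two gives one Kaehler identity; exchanging the roles of delF and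
    delbarF gives the other. *)

Set Implicit Arguments.
Unset Strict Implicit.
Unset Printing Implicit Defensive.

Import Order.TTheory GRing.Theory Num.Theory.
Local Open Scope classical_set_scope.
Local Open Scope quotient_scope.
Local Open Scope ring_scope.

(** * Components in a direct sum *)

Section DirectSumTheory.
Variables (A : nzRingType) (V : lmodType A) (I : choiceType) (G : I -> set V).
Implicit Types (u v w : V) (x y : I -> V).

Lemma fsum_seq (W : nmodType) (r : seq I) (x : I -> W) : uniq r ->
  (forall i, i \notin r -> x i = 0) -> \sum_(i \in [set: I]) x i = \sum_(i <- r) x i.
Proof.
move=> ur xr; rewrite [RHS]fsbig_seq //; apply/esym/fsbig_widen => //= i [_ ir].
by rewrite /= xr//; apply/negP.
Qed.

Lemma decompositionP v x : (exists r : seq I, [/\ uniq r, forall i, G i (x i),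
  forall i, i \notin r -> x i = 0 & v = \sum_(i <- r) x i]) <-> decomposition G v x.
Proof.
split=> [[r [ur Gx xr ->]]|[Gx fx ->]].
  split=> //; last by rewrite (fsum_seq ur).
  apply: (@sub_finite_set _ _ [set` r]) => [i /= xi|]; last exact: finite_seq.
  by apply: contraNT xi => /xr ->.
have /finite_seqP[s sE] := fx.
have xs i : i \notin undup s -> x i = 0.
  rewrite mem_undup; apply: contraNeq => xi.
  by have : [set i | x i != 0] i by []; rewrite sE.
by exists (undup s); split; rewrite ?undup_uniq// (@fsum_seq _ (undup s)) ?undup_uniq.
Qed.

Hypothesis dsG : is_direct_sum G.

Lemma grade0 i : G i 0. Proof. by have [/(_ i)[]] := dsG. Qed.

Lemma gradeZD i c u v : G i u -> G i v -> G i (c *: u + v).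
Proof. by case: dsG => subG _; have [_] := subG i; apply. Qed.

Lemma gradeD i u v : G i u -> G i v -> G i (u + v).
Proof. by move=> Gu Gv; rewrite -[u]scale1r; exact: gradeZD. Qed.

Lemma gradeZ i c u : G i u -> G i (c *: u).
Proof. by move=> Gu; rewrite -[_ *: _]addr0; apply: gradeZD => //; exact: grade0. Qed.

Lemma gradeN i u : G i u -> G i (- u).
Proof. by rewrite -scaleN1r; exact: gradeZ. Qed.

Lemma gradeB i u v : G i u -> G i v -> G i (u - v).
Proof. by move=> Gu /gradeN; exact: gradeD. Qed.

Lemma component_decomposition v : decomposition G v (fun i => component G i v).
Proof.
have [_ /(_ v)[x [dx _]]] := dsG.
by rewrite /component; case: xgetP => // /(_ x).
Qed.

Lemma decomposition_component v x :
  decomposition G v x -> forall i, x i = component G i v.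
Proof.
have [_ /(_ v)[y [_ uy]]] := dsG => /uy <- i.
by rewrite (uy _ (component_decomposition v)).
Qed.

Lemma component_grade i v : G i (component G i v).
Proof. by have [] := component_decomposition v. Qed.

Lemma component_linear i : linear (component G i).
Proof.
move=> c u v.
have /decompositionP[r [ur _ ru uE]] := component_decomposition u.
have /decompositionP[s [us _ sv vE]] := component_decomposition v.
apply/esym; apply: (@decomposition_component _
  (fun i => c *: component G i u + component G i v)).
apply/decompositionP; exists (undup (r ++ s)); split.
- exact: undup_uniq.
- by move=> j; apply: gradeZD; exact: component_grade.
- move=> j; rewrite mem_undup mem_cat negb_or => /andP[jr js].
  by rewrite ru// sv// scaler0 addr0.
- have sub (x : I -> V) (w : V) (q : seq I) : uniq q -> (forall j, j \notin q -> x j = 0) ->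
      {subset q <= undup (r ++ s)} -> w = \sum_(j <- q) x j ->
      w = \sum_(j <- undup (r ++ s)) x j.
    move=> uq qx sq ->; rewrite -(fsum_seq uq qx) -(fsum_seq (undup_uniq (r ++ s)))//.
    by move=> j jrs; apply: qx; apply: contraNN jrs; exact: sq.
  rewrite big_split -scaler_sumr /= -(sub _ u r)// -?(sub _ v s)//.
    by move=> j js; rewrite mem_undup mem_cat js orbT.
  by move=> j jr; rewrite mem_undup mem_cat jr.
Qed.

Definition component_fun i : {linear V -> V} :=
  HB.pack (component G i) (GRing.isLinear.Build _ _ _ _ _ (component_linear i)).

Lemma componentD i u v : component G i (u + v) = component G i u + component G i v.
Proof. exact: (linearD (component_fun i)). Qed.

Lemma component0 i : component G i 0 = 0.
Proof. exact: (linear0 (component_fun i)). Qed.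

Lemma componentN i u : component G i (- u) = - component G i u.
Proof. exact: (linearN (component_fun i)). Qed.

Lemma component_sum i (J : Type) (r : seq J) (P : pred J) (x : J -> V) :
  component G i (\sum_(j <- r | P j) x j) = \sum_(j <- r | P j) component G i (x j).
Proof. exact: (linear_sum (component_fun i)). Qed.

Lemma component_of i j v : G i v -> component G j v = if j == i then v else 0.
Proof.
move=> Gv; apply/esym.
apply: (@decomposition_component v (fun j => if j == i then v else 0)).
apply/decompositionP; exists [:: i]; split=> //.
- by move=> k; case: eqP => [->|_]//; exact: grade0.
- by move=> k; rewrite inE => /negbTE ->.
- by rewrite big_seq1 eqxx.
Qed.

Lemma component_id i v : G i v -> component G i v = v.
Proof. by move=> /(component_of i) ->; rewrite eqxx. Qed.

Lemma component_neq i j v : G i v -> j != i -> component G j v = 0.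
Proof. by move=> /(component_of j) -> /negbTE ->. Qed.

Lemma direct_sum_ind (P : V -> Prop) : P 0 ->
  (forall u v, P u -> P v -> P (u + v)) -> (forall i v, G i v -> P v) ->
  forall v, P v.
Proof.
move=> P0 PD PG v.
have /decompositionP[r [_ _ _ ->]] := component_decomposition v.
by elim/big_rec: _ => // i u _; apply: PD; apply: PG; exact: component_grade.
Qed.

Lemma fsum_component_of (W : nmodType) (f : I -> V -> W) i v :
  (forall j, f j 0 = 0) -> G i v ->
  \sum_(j \in [set: I]) f j (component G j v) = f i v.
Proof.
move=> f0 Gv; rewrite (@fsum_seq _ [:: i])// ?big_seq1 ?(component_id Gv)// => j.
by rewrite inE => ji; rewrite (component_neq Gv ji) f0.
Qed.

(** The index set is infinite, so additivity of the sum needs a common finite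
    support of the two families of components. *)
Lemma fsum_component_linear (W : lmodType A) (f : I -> V -> W) :
  (forall i, linear (f i)) ->
  linear (fun v => \sum_(i \in [set: I]) f i (component G i v)).
Proof.
move=> fL; have f0 i : f i 0 = 0.
  by have := fL i (-1) 0 0; rewrite !scaleN1r oppr0 addr0 addNr.
move=> c u v.
have /decompositionP[r [ur _ ru _]] := component_decomposition u.
have /decompositionP[s [us _ sv _]] := component_decomposition v.
have sum_rs w : (forall j, j \notin undup (r ++ s) -> component G j w = 0) ->
    \sum_(i \in [set: I]) f i (component G i w) =
    \sum_(i <- undup (r ++ s)) f i (component G i w).
  by move=> x0; apply: fsum_seq; rewrite ?undup_uniq// => j /x0 ->; exact: f0.
rewrite !sum_rs => [|j|j|j]; try by
    rewrite mem_undup mem_cat negb_or => /andP[jr js];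
    rewrite ?component_linear ?(ru _ jr) ?(sv _ js) ?scaler0 ?addr0.
rewrite scaler_sumr -big_split; apply: eq_bigr => i _ /=.
by rewrite component_linear fL.
Qed.

End DirectSumTheory.

(** * Parity, conjugation and the Dolbeault operators *)

Section ComplexForms.
Variables (R : realType) (B Omega : algType R[i]) (sB : star_algebra B).
Variables (cal : calculus B Omega) (sC : star_calculus sB cal).
Variable cs : complex_structure sC.
Implicit Types (w v x y : Omega) (a b c e k l : nat).

Local Notation bgrade := (fun p : nat * nat => bform cs p.1 p.2).
Local Notation bpart p := (component bgrade p).

Lemma signmE k w : (-1) ^+ k * w = if odd k then - w else w.
Proof. by rewrite -signr_odd mulr_sign. Qed.

(** A form of bidegree (a, b) is the sum whose only nonzero term has index a in
    the decomposition of forms of degree a + b. *)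
Lemma bform_form a b w : bform cs a b w -> form cal (a + b) w.
Proof.
move=> abw; apply/(form_bform cs).
exists (fun c => if c == a then w else 0) => [c cab|].
  case: eqP => [->|_]; first by rewrite addKn.
  exact: (grade0 (bform_direct cs) (c, (a + b - c)%N)).
have aab : (a < (a + b).+1)%N by lia.
by rewrite (bigD1 (Ordinal aab))//= eqxx big1 ?addr0// => c /negbTE; rewrite -val_eqE /= => ->.
Qed.

Lemma bform_ind (P : Omega -> Prop) : P 0 ->
  (forall w v, P w -> P v -> P (w + v)) -> (forall a b w, bform cs a b w -> P w) ->
  forall w, P w.
Proof.
by move=> P0 PD Pb; apply: (direct_sum_ind (bform_direct cs)) => // -[a b]; exact: Pb.
Qed.

Lemma form_ind (P : Omega -> Prop) : P 0 ->
  (forall w v, P w -> P v -> P (w + v)) -> (forall k w, form cal k w -> P w) ->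
  forall w, P w.
Proof. exact: (direct_sum_ind (form_direct cal)). Qed.

Lemma form_bform_ind k (P : Omega -> Prop) : P 0 ->
  (forall w v, P w -> P v -> P (w + v)) ->
  (forall a b w, (a + b = k)%N -> bform cs a b w -> P w) ->
  forall w, form cal k w -> P w.
Proof.
move=> P0 PD Pb w /(form_bform cs)[u uk ->].
elim/big_rec: _ => // a v _; apply: PD; have ak : (a <= k)%N by rewrite -ltnS.
by apply: (Pb a (k - a)%N) => //; [rewrite subnKC|exact: uk].
Qed.

Lemma starD w v : sC (w + v) = sC w + sC v.
Proof. by have := fstar_linear sC 1 w v; rewrite !scale1r rmorph1 scale1r. Qed.

Lemma star0 : sC 0 = 0.
Proof. by apply: (addIr (sC 0)); rewrite -starD !add0r. Qed.

Lemma starZ (z : R[i]) w : sC (z *: w) = z^* *: sC w.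
Proof. by have := fstar_linear sC z w 0; rewrite star0 !addr0. Qed.

Lemma starN w : sC (- w) = - sC w.
Proof. by rewrite -scaleN1r starZ rmorphN1 scaleN1r. Qed.

Lemma bform_starr a b w : bform cs a b w -> bform cs b a (sC w).
Proof. by move=> abw; rewrite -(bform_star cs a b); exists w. Qed.

Lemma form_star k w : form cal k w -> form cal k (sC w).
Proof.
move: w; apply: form_bform_ind => [|w v kw kv|a b w abk abw].
- by rewrite star0; exact: grade0 (form_direct cal) k.
- by rewrite starD; exact: gradeD (form_direct cal) k _ _ kw kv.
- by rewrite -abk addnC; apply: bform_form; exact: bform_starr.
Qed.

Lemma parity_linear : linear (parity cal).
Proof.
apply: (fsum_component_linear (form_direct cal)
  (f := fun k w => (-1) ^+ k * w)) => k z w v.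
by rewrite mulrDr scalerAr.
Qed.

Definition parity_fun : {linear Omega -> Omega} :=
  HB.pack (parity cal) (GRing.isLinear.Build _ _ _ _ _ parity_linear).

Lemma parityD w v : parity cal (w + v) = parity cal w + parity cal v.
Proof. exact: (linearD parity_fun). Qed.
Lemma parity0 : parity cal 0 = 0.
Proof. exact: (linear0 parity_fun). Qed.
Lemma parityZ (z : R[i]) w : parity cal (z *: w) = z *: parity cal w.
Proof. exact: (linearZ_LR parity_fun). Qed.

Lemma parity_form k w : form cal k w -> parity cal w = (-1) ^+ k * w.
Proof.
by apply: (fsum_component_of (form_direct cal) (f := fun k w => (-1) ^+ k * w)) => // j;
  rewrite mulr0.
Qed.

Lemma parity_bform a b w : bform cs a b w -> parity cal w = (-1) ^+ (a + b) * w.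
Proof. by move/bform_form; exact: parity_form. Qed.

Lemma form_parity k w : form cal k w -> form cal k (parity cal w).
Proof.
move=> kw; rewrite (parity_form kw) signmE.
by case: odd => //; apply: gradeN => //; exact: form_direct.
Qed.

Lemma parityM w v : parity cal (w * v) = parity cal w * parity cal v.
Proof.
move: w; apply: form_ind => [|w w' E E'|k w kw]; rewrite ?(mul0r, parity0)//.
  by rewrite mulrDl !parityD E E' mulrDl.
move: v; apply: form_ind => [|v v' E E'|l v lv]; rewrite ?(mulr0, parity0)//.
  by rewrite mulrDr !parityD E E' mulrDr.
rewrite (parity_form kw) (parity_form lv) (parity_form (form_mul kw lv)).
by rewrite exprD -!mulrA; congr (_ * _); rewrite !signmE; case: odd; rewrite ?mulrN.
Qed.

Lemma parityK w : parity cal (parity cal w) = w.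
Proof.
move: w; apply: form_ind => [|w w' E E'|k w kw]; rewrite ?parity0//.
  by rewrite !parityD E E'.
by rewrite (parity_form (form_parity kw)) (parity_form kw) mulrA -expr2 sqrr_sign mul1r.
Qed.

Lemma parity_star w : parity cal (sC w) = sC (parity cal w).
Proof.
move: w; apply: form_ind => [|w w' E E'|k w kw]; rewrite ?(star0, parity0)//.
  by rewrite !(starD, parityD) ?starD E E'.
rewrite (parity_form kw) (parity_form (form_star kw)) !signmE.
by case: odd; rewrite ?starN.
Qed.

Lemma incl_form (r : B) : form cal 0 (incl cal r).
Proof. by rewrite form0E; exists r. Qed.

Lemma parity_incl (r : B) : parity cal (incl cal r) = incl cal r.
Proof. by rewrite (parity_form (incl_form r)) expr0 mul1r. Qed.

Lemma incl_bform (r : B) : bform cs 0 0 (incl cal r).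
Proof.
have /(form_bform cs)[u u00 ->] := incl_form r; rewrite big_ord1.
by have := u00 0 (leqnn _); rewrite subnn.
Qed.

Definition bidegree d1 d2 (D : Omega -> Omega) :=
  forall a b w, bform cs a b w -> bform cs (a + d1) (b + d2) (D w).

Lemma bpart_bidegree d1 d2 (D : {linear Omega -> Omega}) : bidegree d1 d2 D ->
  forall a b w, bpart (a + d1, b + d2)%N (D w) = D (bpart (a, b) w).
Proof.
have dB := bform_direct cs.
move=> dD a b w; move: w; apply: bform_ind => [|w v E E'|c e w cew].
- by rewrite !(component0 dB, linear0).
- by rewrite !(componentD dB, linearD) E E'.
rewrite (component_of dB _ (i := (c, e)) cew).
rewrite (component_of dB _ (i := (c + d1, e + d2)%N) (dD _ _ _ cew)).
by rewrite !xpair_eqE !eqn_add2r; case: ifP => // _; rewrite linear0.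
Qed.

(** The pair (del, delbar) and the pair (delbar, del) have the same properties
    up to the exchange of d1 and d2; treating both at once gives each identity
    together with its conjugate. *)
Definition dolbeault d1 d2 (D D' : Omega -> Omega) :=
  [/\ (d1 + d2 = 1)%N, bidegree d1 d2 D, bidegree d2 d1 D'
    & forall w, dif cal w = D w + D' w].

Lemma dolbeault_sym d1 d2 D D' : dolbeault d1 d2 D D' -> dolbeault d2 d1 D' D.
Proof.
by move=> [d12 bD bD' E]; split=> // [|w]; rewrite 1?addnC// E addrC.
Qed.

Lemma dolbeault_del : dolbeault 1 0 (del cs) (delbar cs).
Proof.
split=> // [a b w /(bform_del)|a b w /(bform_delbar)|w]; rewrite ?addn1 ?addn0//.
exact: difE.
Qed.

Section Dolbeault.
Variables (d1 d2 : nat) (D D' : {linear Omega -> Omega}).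
Hypothesis DD' : dolbeault d1 d2 D D'.

Lemma bpart_dolbeault a b w : bform cs a b w ->
  bpart (a + d1, b + d2)%N (dif cal w) = D w.
Proof.
move=> abw; have [d12 bD bD' ->] := DD'.
rewrite (componentD (bform_direct cs)).
rewrite (component_id (bform_direct cs) (i := (a + d1, b + d2)%N) (bD _ _ _ abw)).
rewrite (component_neq (bform_direct cs) (i := (a + d2, b + d1)%N) (bD' _ _ _ abw)).
  by rewrite addr0.
by rewrite xpair_eqE; lia.
Qed.

(** The part of bidegree (d1, d2) of the Leibniz rule for the differential. *)
Lemma dolbeaultM w v : D (w * v) = D w * v + parity cal w * D v.
Proof.
have dB := bform_direct cs; have [d12 bD bD' difE] := DD'.
move: w; apply: bform_ind => [|w w' E E'|a b w abw].
- by rewrite !(linear0, mul0r, parity0) addr0.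
- by rewrite mulrDl !linearD E E' parityD !mulrDl addrACA.
move: v; apply: bform_ind => [|v v' E E'|c e v cev].
- by rewrite !(linear0, mulr0) addr0.
- by rewrite mulrDr !linearD E E' !mulrDr addrACA.
have abcev := bform_mul abw cev.
rewrite -(bpart_dolbeault abcev) (dif_mul v (bform_form abw)) !difE.
rewrite mulrDl !mulrDr !(componentD dB).
have pos a' b' z : bform cs a' b' z -> bpart (a', b') z = z.
  by move=> zab; exact: (component_id dB (i := (a', b')) zab).
have neg a' b' c' e' z : bform cs c' e' z -> (a', b') != (c', e') -> bpart (a', b') z = 0.
  by move=> xyz; exact: (component_neq dB (i := (c', e')) xyz).
have sgn k a' b' z : bform cs a' b' z -> bform cs a' b' ((-1) ^+ k * z).
  by move=> xyz; rewrite signmE; case: odd => //; exact: (gradeN dB (i := (a', b'))).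
rewrite (parity_bform abw) -!mulrA; congr (_ + _).
  rewrite (neg _ _ (a + d2 + c)%N (b + d1 + e)%N (D' w * v)) ?addr0.
  - by apply: pos; rewrite addnAC [(b + e + d2)%N]addnAC; exact/bform_mul/cev/bD.
  - exact/bform_mul/cev/bD'.
  - by rewrite xpair_eqE; lia.
rewrite (neg _ _ (a + (c + d2))%N (b + (e + d1))%N _ (sgn _ _ _ (w * D' v) _)) ?addr0.
- by apply/pos/sgn; rewrite -!addnA; exact/bform_mul/bD.
- exact/bform_mul/bD'.
- by rewrite xpair_eqE; lia.
Qed.

(** The part of bidegree (2 d1, 2 d2) of the vanishing of the square of the
    differential. *)
Lemma dolbeault_sqr w : D (D w) = 0.
Proof.
have dB := bform_direct cs; have [d12 bD bD' difE] := DD'.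
move: w; apply: bform_ind => [|w w' E E'|a b w abw].
- by rewrite !linear0.
- by rewrite !linearD E E' addr0.
rewrite -(bpart_dolbeault (bD _ _ _ abw)); have := dif_dif cal w.
rewrite [dif cal w]difE linearD => /(canRL (addrK _)) ->; rewrite sub0r (componentN dB).
rewrite difE (componentD dB).
rewrite (component_neq dB (i := (a + d2 + d1, b + d1 + d2)%N)).
- rewrite (component_neq dB (i := (a + d2 + d2, b + d1 + d1)%N)) ?addr0 ?oppr0//.
    exact/bD'/bD'.
  by rewrite xpair_eqE; lia.
- exact/bD/bD'.
- by rewrite xpair_eqE; lia.
Qed.

Lemma dolbeault_closed a b w : bform cs a b w -> dif cal w = 0 -> D w = 0.
Proof.
by move=> abw; rewrite -(bpart_dolbeault abw) => ->; rewrite (component0 (bform_direct cs)).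
Qed.

Lemma dolbeault_star w : sC (D w) = D' (sC w).
Proof.
have dB := bform_direct cs; have [d12 bD bD' difE] := DD'.
move: w; apply: bform_ind => [|w w' E E'|a b w abw].
- by rewrite !(linear0, star0).
- by rewrite !(linearD, starD) /= E E'.
have := fstar_dif sC w; rewrite !difE starD => /(congr1 (component bgrade (b + d2, a + d1)%N)).
have pos a' b' z : bform cs a' b' z -> bpart (a', b') z = z.
  by move=> zab; exact: (component_id dB (i := (a', b')) zab).
have neg a' b' c' e' z : bform cs c' e' z -> (a', b') != (c', e') -> bpart (a', b') z = 0.
  by move=> xyz; exact: (component_neq dB (i := (c', e')) xyz).
rewrite !(componentD dB) (neg _ _ (b + d1)%N (a + d2)%N (D (sC w))).
- rewrite (neg _ _ (b + d1)%N (a + d2)%N (sC (D' w))).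
  + rewrite add0r addr0 (pos _ _ (D' _)); last exact/bD'/bform_starr.
    by rewrite (pos _ _ (sC _)) => [->//|]; exact/bform_starr/bD.
  + exact/bform_starr/bD'.
  + by rewrite xpair_eqE; lia.
- exact/bD/bform_starr.
- by rewrite xpair_eqE; lia.
Qed.

Lemma dolbeault_parity w : D (parity cal w) = - parity cal (D w).
Proof.
have [d12 bD bD' difE] := DD'.
move: w; apply: bform_ind => [|w w' E E'|a b w abw].
- by rewrite parity0 linear0 parity0 oppr0.
- by rewrite parityD !linearD parityD E E' opprD.
rewrite (parity_bform abw) (parity_bform (bD _ _ _ abw)) addnACA d12 addn1 exprS mulN1r.
by rewrite mulNr opprK !signmE; case: odd; rewrite ?linearN.
Qed.

End Dolbeault.

(** Up to sign this is exterior multiplication by x.  The sign makes the operator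
    odd, like a differential; this is the zeroth order part of a connection as it
    is seen through the Hermitian pairing. *)
Definition rmul_parity (x w : Omega) := parity cal w * x.

Lemma rmul_parity_linear x : linear (rmul_parity x).
Proof. by move=> z w v; rewrite /rmul_parity parityD parityZ mulrDl scalerAl. Qed.

Definition rmul_parity_fun x : {linear Omega -> Omega} :=
  HB.pack (rmul_parity x) (GRing.isLinear.Build _ _ _ _ _ (rmul_parity_linear x)).

Lemma rmul_parity_bidegree d1 d2 x : bform cs d1 d2 x -> bidegree d1 d2 (rmul_parity x).
Proof.
move=> dx a b w abw; apply: bform_mul => //.
rewrite (parity_bform abw) signmE; case: odd => //.
exact: (gradeN (bform_direct cs) (i := (a, b))).
Qed.

End ComplexForms.

(** * The coefficients of the Hodge map *)

Section HodgeCoefficients.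
Variable C : numClosedFieldType.

(** This is the factor i^(a - b); with exponents in nat it is multiplicative in
    the bidegree and its square depends on the degree a + b only. *)
Definition phase (a b : nat) : C := 'i ^+ a * (- 'i) ^+ b.

Lemma phase_int a b : 'i ^ (a%:Z - b%:Z) = phase a b.
Proof. by rewrite expfzDr ?neq0Ci// -invr_expz -!exprnP -exprVn invCi. Qed.

Lemma phaseD a b c d : phase (a + c) (b + d) = phase a b * phase c d.
Proof. by rewrite /phase !exprD; ring. Qed.

Lemma phaseS a b : phase a.+1 b.+1 = phase a b.
Proof.
by rewrite /phase !exprS mulrACA mulrN -expr2 sqrCi opprK mul1r.
Qed.

Lemma phase_sqr a b : phase a b * phase a b = (-1) ^+ (a + b).
Proof.
by rewrite -expr2 exprMn -!exprM ![(_ * 2)%N]mulnC !exprM sqrrN sqrCi -exprD.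
Qed.

Lemma phase_conj a b : (phase a b)^* = phase b a.
Proof. by rewrite rmorphM !rmorphXn /= rmorphN /= conjCi opprK mulrC. Qed.

Definition hsign k : C := (-1) ^+ (k * k.+1)./2.

Lemma hsignS k : hsign k.+1 = hsign k * (-1) ^+ k.+1.
Proof.
rewrite /hsign -exprD; congr (_ ^+ _).
have -> : (k.+1 * k.+2 = k * k.+1 + (k.+1).*2)%N by lia.
by rewrite halfD odd_double andbF add0n doubleK.
Qed.

Lemma hsign_sqr k : hsign k * hsign k = 1.
Proof. by rewrite /hsign -expr2 sqrr_sign. Qed.

Lemma hsign_conj k : (hsign k)^* = hsign k.
Proof. by rewrite /hsign rmorphXn rmorphN1. Qed.

Variable n : nat.

(** The scalar with hodge (L^j x) = hcoef a b j *: L^(n - j - (a + b)) x for x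
    primitive of bidegree (a, b). *)
Definition hcoef a b j : C :=
  hsign (a + b) * phase a b * (j`!%:R / (n - j - (a + b))`!%:R).

Lemma fact_neq0 j : j`!%:R != 0 :> C.
Proof. by rewrite pnatr_eq0 -lt0n fact_gt0. Qed.

Lemma hcoef_conj a b j : (hcoef a b j)^* = hcoef b a j.
Proof.
by rewrite /hcoef 2!rmorphM /= hsign_conj phase_conj fmorph_div /= !rmorph_nat addnC.
Qed.

(** The factorials cancel, and the square of the phase gives the sign. *)
Lemma hcoef_sqr a b j : (j <= n - (a + b))%N ->
  hcoef a b j * hcoef a b (n - j - (a + b)) = (-1) ^+ (a + b).
Proof.
move=> jn; rewrite /hcoef.
have -> : (n - (n - j - (a + b)) - (a + b) = j)%N by lia.
have j0 := fact_neq0 j; have e0 := fact_neq0 (n - j - (a + b)).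
transitivity (hsign (a + b) * hsign (a + b) * (phase a b * phase a b)).
  by field; rewrite j0 e0.
by rewrite hsign_sqr mul1r phase_sqr.
Qed.

Lemma hcoefS a b j : (j < n - (a + b))%N ->
  hcoef a b j.+1 = (j.+1 * (n - j - (a + b)))%:R * hcoef a b j.
Proof.
move=> jn; rewrite /hcoef (_ : (n - j - (a + b) = (n - j.+1 - (a + b)).+1)%N); last by lia.
rewrite !factS !natrM.
have e0 := fact_neq0 (n - j.+1 - (a + b)).
have e1 : (n - j.+1 - (a + b)).+1%:R != 0 :> C by rewrite pnatr_eq0.
by field; rewrite nat1r e0 e1.
Qed.

(** Together with hcoef_down, the scalar content of the Kaehler identities: x of
    bidegree (a, b) is moved by an operator of bidegree (c, d) to a primitive form
    of degree one higher here, and to L applied to a primitive form of degree one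
    lower in hcoef_down. *)
Lemma hcoef_up a b c d j : (c + d = 1)%N -> (0 < j)%N -> (j <= n - (a + b))%N ->
  phase c d * (hcoef a b j * hcoef (a + c) (b + d) (n - j - (a + b))) = j%:R.
Proof.
move=> cd j0 jn; rewrite /hcoef addnACA cd addn1 hsignS phaseD.
have -> : (n - (n - j - (a + b)) - (a + b).+1 = j.-1)%N by lia.
case: j j0 jn => // j _ jn /=; rewrite factS natrM.
have k0 := fact_neq0 j; have e0 := fact_neq0 (n - j.+1 - (a + b)).
have pp := phase_sqr a b; have zz := phase_sqr c d; rewrite cd expr1 in zz.
have ss := hsign_sqr (a + b); have kk : (-1) ^+ (a + b) * (-1) ^+ (a + b) = 1 :> C.
  by rewrite -expr2 sqrr_sign.
transitivity ((phase c d * phase c d) * (phase a b * phase a b) *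
  (hsign (a + b) * hsign (a + b)) * (- (-1) ^+ (a + b)) * j.+1%:R).
  by rewrite exprS mulN1r; field; rewrite k0 e0.
by rewrite zz pp ss mulr1 mulN1r mulrNN kk mul1r.
Qed.

Lemma hcoef_down a b c d a' b' j :
  (c + d = 1)%N -> (a + c = a'.+1)%N -> (b + d = b'.+1)%N -> (j <= n - (a + b))%N ->
  (a + b <= n)%N ->
  phase c d * (hcoef a b j * hcoef a' b' (n - j - (a + b)).+1) =
  - (n - j - (a + b)).+1%:R.
Proof.
move=> cd aE bE jn abn; rewrite /hcoef.
have -> : (n - (n - j - (a + b)).+1 - (a' + b') = j)%N by lia.
have abE : (a + b = (a' + b').+1)%N by lia.
have -> : phase a' b' = phase a b * phase c d by rewrite -phaseD aE bE phaseS.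
have -> : hsign (a + b) = hsign (a' + b') * (-1) ^+ (a + b) by rewrite abE hsignS.
rewrite factS natrM.
have k0 := fact_neq0 j; have e0 := fact_neq0 (n - j - (a + b)).
have pp := phase_sqr a b; have zz := phase_sqr c d; rewrite cd expr1 in zz.
have ss := hsign_sqr (a' + b').
have kk : (-1) ^+ (a + b) * (-1) ^+ (a + b) = 1 :> C by rewrite -expr2 sqrr_sign.
transitivity ((phase c d * phase c d) * (phase a b * phase a b) *
  (hsign (a' + b') * hsign (a' + b')) * (-1) ^+ (a + b) * (n - j - (a + b)).+1%:R).
  by field; rewrite k0 e0.
by rewrite zz pp ss mulr1 mulN1r mulNr kk mulN1r.
Qed.

End HodgeCoefficients.

(** * The Lefschetz decomposition and the existence of the Hodge map *)

Section Lefschetz.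
Variables (R : realType) (B Omega : algType R[i]) (sB : star_algebra B).
Variables (cal : calculus B Omega) (sC : star_calculus sB cal) (n : nat).
Hypothesis cal_degree : total_degree cal n.*2.
Variable K : kahler_structure n sC.
Implicit Types (w v x y : Omega) (a b c e j k l : nat).

Local Notation bgrade := (fun p : nat * nat => bform K p.1 p.2).
Local Notation bpart p := (component bgrade p).
Local Notation kap := (kappa K).
Local Notation dB := (bform_direct K).

Definition lmul_linear x : linear ( *%R x ).
Proof. by move=> z u v; rewrite mulrDr scalerAr. Qed.

Definition lmul_fun x : {linear Omega -> Omega} :=
  HB.pack ( *%R x ) (GRing.isLinear.Build _ _ _ _ _ (lmul_linear x)).

Lemma form_over k w : (n.*2 < k)%N -> form cal k w -> w = 0.
Proof. by have [_] := cal_degree; apply. Qed.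

Lemma iter_lefschetz j w : iter j (lefschetz K) w = kap ^+ j * w.
Proof.
by elim: j => [|j /= ->]; rewrite ?mul1r// /lefschetz exprS mulrA.
Qed.

Lemma kappaX_bform j : bform K j j (kap ^+ j).
Proof.
elim: j => [|j IHj]; first by rewrite expr0 -(rmorph1 (incl cal)); exact: incl_bform.
by rewrite exprS -add1n; apply: bform_mul => //; exact: kappa11.
Qed.

Lemma kappaX_bidegree j : bidegree K j j ( *%R (kap ^+ j)).
Proof.
move=> a b w abw; rewrite ![(_ + j)%N]addnC; apply: bform_mul => //.
exact: kappaX_bform.
Qed.

Lemma bpart_kappaX j a b w :
  bpart (a + j, b + j)%N (kap ^+ j * w) = kap ^+ j * bpart (a, b) w.
Proof. exact: (bpart_bidegree (D := lmul_fun (kap ^+ j)) (@kappaX_bidegree j)). Qed.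

Lemma bpart_bform a b a' b' w : bform K a b w ->
  bpart (a', b') w = if (a' == a) && (b' == b) then w else 0.
Proof. by move=> /(component_of dB (i := (a, b)) (a', b')). Qed.

Lemma bpart_id a b w : bform K a b w -> bpart (a, b) w = w.
Proof. by move=> /bpart_bform ->; rewrite !eqxx. Qed.

Lemma bpart_grade a b w : bform K a b (bpart (a, b) w).
Proof. exact: (component_grade dB (a, b)). Qed.

Lemma bpart_kappaX_lt j a b w : ((a < j) || (b < j))%N ->
  bpart (a, b) (kap ^+ j * w) = 0.
Proof.
move=> ltj; move: w; apply: (bform_ind (cs := K)) => [|w v E E'|c e w cew].
- by rewrite mulr0 (component0 dB).
- by rewrite mulrDr (componentD dB) E E' addr0.
- by rewrite (bpart_bform _ _ (kappaX_bidegree j cew)) ifF//; lia.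
Qed.

Lemma kappaX_form j k w : form cal k w -> form cal (j.*2 + k)%N (kap ^+ j * w).
Proof.
by apply: form_mul; rewrite -addnn; apply: (bform_form (cs := K)); exact: kappaX_bform.
Qed.

Lemma kappaX_inj k w : (k <= n)%N -> form cal k w -> kap ^+ (n - k) * w = 0 -> w = 0.
Proof.
rewrite leq_eqVlt => /orP[/eqP ->|kn] kw; first by rewrite subnn mul1r.
have [_ inj _] := kappa_lefschetz K kn => w0.
apply: inj; rewrite ?inE//; first exact: grade0 (form_direct cal) k.
by have := iter_lefschetz (n - k)%N; rewrite /lefschetz => E; rewrite !E mulr0.
Qed.

Lemma kappaX_surj k v : (k <= n)%N -> form cal (n.*2 - k)%N v ->
  exists2 w, form cal k w & kap ^+ (n - k) * w = v.
Proof.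
rewrite leq_eqVlt => /orP[/eqP -> nv|kn].
  by exists v; rewrite ?subnn ?mul1r//; move: nv; rewrite -addnn addnK.
have [_ _ surj] := kappa_lefschetz K kn => /surj[w kw <-]; exists w => //.
by have := iter_lefschetz (n - k)%N; rewrite /lefschetz => ->.
Qed.

(** For a + b <= n these are the primitive forms.  In degree n + 1 the power of
    kappa is 0, so that only x = 0 remains: the first term of primitive_split then
    makes sense for the image of a primitive form of degree n under an operator of
    degree 1. *)
Definition wprim a b x :=
  bform K a b x /\ kap ^+ (n.+1 - (a + b)) * x = 0.

Lemma primitive_wprim a b x : (a + b <= n)%N -> primitive K a b x <-> wprim a b x.
Proof. by move=> abn; rewrite /wprim subSn// -iter_lefschetz. Qed.

Lemma wprim_kill a b x j : (n < a + b + j)%N -> wprim a b x -> kap ^+ j * x = 0.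
Proof.
move=> nj [_ x0]; have -> : j = (j - (n.+1 - (a + b)) + (n.+1 - (a + b)))%N by lia.
by rewrite exprD -mulrA x0 mulr0.
Qed.

(** With k = a + b, the form L^(n + 1 - k) w has degree 2n - (k - 2), hence is
    L^(n + 2 - k) v for a form v of degree k - 2, and L^(n + 1 - k) kills
    w - L v.  Taking the component of v of bidegree (a - 1, b - 1) keeps this
    property.  If a or b is 0 there is no such bidegree and w is primitive. *)
Lemma primitive_split a b w : (a + b <= n.+1)%N -> bform K a b w ->
  exists v, wprim a b (w - kap * v) /\
    (v = 0 \/ exists a' b', [/\ a = a'.+1, b = b'.+1 & bform K a' b' v]).
Proof.
move=> abn abw; have abf := bform_form abw.
have [ab2|ab2] := ltnP (a + b) 2.
  exists 0; split; last by left.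
  rewrite mulr0 subr0; split=> //.
  have := kappaX_form (n.+1 - (a + b)) abf; apply: form_over; lia.
have k'E : (n - (a + b - 2) = (n.+1 - (a + b)).+1)%N by lia.
have [||v0 v0f v0E] := @kappaX_surj (a + b - 2) (kap ^+ (n.+1 - (a + b)) * w).
- by lia.
- rewrite (_ : (n.*2 - (a + b - 2) = (n.+1 - (a + b)).*2 + (a + b))%N); last by lia.
  exact: kappaX_form.
rewrite k'E in v0E.
(* The component of v0 to keep is the one that multiplication by
   kap ^+ (n + 2 - (a + b)) sends to the bidegree of the left-hand side. *)
have wE : kap ^+ (n.+1 - (a + b)) * w =
    bpart (a + (n.+1 - (a + b)), b + (n.+1 - (a + b)))%N
       (kap ^+ (n.+1 - (a + b)).+1 * v0).
  by rewrite v0E bpart_kappaX bpart_id.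
case: a => [|a] in abn abw abf ab2 k'E v0f v0E wE *.
  exists 0; split; last by left.
  by rewrite mulr0 subr0; split=> //; rewrite wE bpart_kappaX_lt// ltnS leqnn.
case: b => [|b] in abn abw abf ab2 k'E v0f v0E wE *.
  exists 0; split; last by left.
  by rewrite mulr0 subr0; split=> //; rewrite wE bpart_kappaX_lt// ltnS leqnn orbT.
exists (bpart (a, b) v0); split; last first.
  by right; exists a, b; split=> //; exact: bpart_grade.
split.
  apply: (gradeB dB (i := (a.+1, b.+1)) abw).
  by have := kappaX_bidegree 1 (bpart_grade a b v0); rewrite !addn1 expr1.
rewrite mulrBr wE mulrA -exprSr !addSnnS.
by rewrite bpart_kappaX subrr.
Qed.

(** No bound on j is imposed, which makes stability under L immediate; the
    superfluous generators vanish. *)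
Inductive lspan : Omega -> Prop :=
| lspan0 : lspan 0
| lspanD w v : lspan w -> lspan v -> lspan (w + v)
| lspan_gen a b j x : (a + b <= n)%N -> wprim a b x -> lspan (kap ^+ j * x).

Lemma lspan_kappaX i w : lspan w -> lspan (kap ^+ i * w).
Proof.
elim=> [|{}w v _ w' _ v'|a b j x abn px]; rewrite ?mulr0 ?mulrDr.
- exact: lspan0.
- exact: lspanD.
- by rewrite mulrA -exprD; exact: lspan_gen px.
Qed.

(** Induction on the first index of the bidegree, which L decreases by one in
    primitive_split. *)
Lemma lspan_low a b w : (a + b <= n)%N -> bform K a b w -> lspan w.
Proof.
elim: a => [|a IHa] in b w * => abn abw.
  have [|v [pw [v0|[? [? []]]]]]// := primitive_split _ abw; first by lia.
  by move: pw; rewrite v0 mulr0 subr0 => pw; rewrite -[w]mul1r; apply: (@lspan_gen 0 b 0).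
have [|v [pw vE]] := primitive_split _ abw; first by lia.
rewrite -[w](subrK (kap * v)); apply: lspanD.
  by rewrite -[_ - _]mul1r; apply: (@lspan_gen a.+1 b 0).
rewrite -[kap]expr1; apply: lspan_kappaX.
have [->|[a' [b' [[aE] bE abv]]]] := vE; first exact: lspan0.
by apply: (IHa b'); rewrite ?aE//; lia.
Qed.

Lemma lspan_form k w : (k <= n)%N -> form cal k w -> lspan w.
Proof.
move=> kn; move: w; apply: (form_bform_ind (cs := K)) => [|w v|a b w abk abw].
- exact: lspan0.
- exact: lspanD.
- by apply: lspan_low abw; rewrite abk.
Qed.

Lemma lspan_all w : lspan w.
Proof.
move: w; apply: (form_ind (cal := cal)) => [|w v|k w kw]; [exact: lspan0|exact: lspanD|].
have [nk|kn] := ltnP n k; last exact: lspan_form kw.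
have [nk'|kn'] := ltnP n.*2 k.
  by rewrite (form_over nk' kw); exact: lspan0.
have [||v kv <-] := @kappaX_surj (n.*2 - k) w; first by lia.
  by rewrite subKn.
by apply: lspan_kappaX; apply: lspan_form kv; lia.
Qed.

(** Linear identities between operators on forms need to be checked on the forms
    L^j x with x primitive only. *)
Lemma lefschetz_ind (P : Omega -> Prop) : P 0 ->
  (forall w v, P w -> P v -> P (w + v)) ->
  (forall a b j x, (a + b <= n)%N -> (j <= n - (a + b))%N -> wprim a b x ->
    P (kap ^+ j * x)) ->
  forall w, P w.
Proof.
move=> P0 PD Pg w; elim: (lspan_all w) => [//|{}w v _ Pw _ Pv|a b j x abn px].
  exact: PD.
have [jn|nj] := leqP j (n - (a + b)); first exact: (Pg a b).
by rewrite (wprim_kill _ px)//; lia.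
Qed.

Local Notation lefI := ('I_n.+1 * 'I_n.+1 * 'I_n.+1)%type.

Definition lef_ok (i : lefI) : bool :=
  ((i.1.1 + i.1.2 <= n) && (i.2 <= n - (i.1.1 + i.1.2)))%N.

Definition lef_family (u : lefI -> Omega) :=
  forall i : lefI, wprim i.1.1 i.1.2 (u i) /\ (~~ lef_ok i -> u i = 0).

Definition lef_sum (u : lefI -> Omega) : Omega := \sum_(i : lefI) kap ^+ i.2 * u i.

Lemma wprimZD z a b x y : wprim a b x -> wprim a b y -> wprim a b (z *: x + y).
Proof.
move=> [xb x0] [yb y0]; split; first exact: (gradeZD dB (i := (a, b))).
by rewrite mulrDr -scalerAr x0 y0 scaler0 addr0.
Qed.

Lemma wprim0 a b : wprim a b 0.
Proof. by split; rewrite ?mulr0//; exact: (grade0 dB (a, b)). Qed.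

Lemma lef_familyZD z u u' : lef_family u -> lef_family u' ->
  lef_family (fun i => z *: u i + u' i).
Proof.
move=> fu fu' i; have [pu ui] := fu i; have [pu' u'i] := fu' i; split.
  exact: wprimZD.
by move=> ni; rewrite ui// u'i// scaler0 addr0.
Qed.

Lemma lef_sumZD z u u' : lef_sum (fun i => z *: u i + u' i) =
  z *: lef_sum u + lef_sum u'.
Proof.
rewrite /lef_sum scaler_sumr -big_split; apply: eq_bigr => i _ /=.
by rewrite mulrDr scalerAr.
Qed.

(** Suppose the parts with a larger power of L vanish.  The power
    L^(n - (a + b) - j) kills the parts of the same total bidegree with a smaller
    power of L, and sends L^j (u i) to L^(n - (a + b)) (u i), which is zero only if
    u i is. *)
Lemma lef_family_inj0 u : lef_family u -> lef_sum u = 0 -> forall i, u i = 0.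
Proof.
move=> fu u0 i; have [p] := ubnP (n - i.2)%N; elim: p => // p IHp in i * => ip.
have [[ui _] uNok] := fu i; have [iok|/uNok//] := boolP (lef_ok i).
case/andP: (iok); case: i => [[a b] j] /= in ip ui uNok iok * => abn jn.
set i := (a, b, j) in ui *; set k := (a + b)%N in abn jn *.
apply: (kappaX_inj (k := k)) => //; first exact: bform_form ui.
have nkE : (n - k = n - k - j + j)%N by rewrite subnK.
(* The bidegree selects the parts whose index differs from i by a multiple
   of (-1, -1, 1). *)
transitivity (bpart (a + (n - k), b + (n - k))%N (kap ^+ (n - k - j) * lef_sum u)).
  2: by rewrite u0 mulr0 (component0 dB).
rewrite /lef_sum mulr_sumr (component_sum dB) (bigD1 i)//= big1 => [|i' i'i].
  by rewrite addr0 mulrA -exprD -nkE bpart_kappaX bpart_id.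
rewrite mulrA -exprD.
have [pi' i'Nok] := fu i'; have [i'ok|/i'Nok->] := boolP (lef_ok i'); last first.
  by rewrite mulr0 (component0 dB).
case/andP: (i'ok); move: pi' => /[dup] pi' [ui' _].
case: i' => [[a' b'] j'] /= in i'i ui' pi' i'Nok i'ok * => abn' jn'.
have [jj'|j'j] := ltnP j j'.
  by rewrite (IHp (a', b', j')) ?mulr0 ?(component0 dB)//=; lia.
rewrite (bpart_bform _ _ (kappaX_bidegree _ ui')).
case: ifP => // /andP[/eqP aE /eqP bE].
have j'j' : (j' < j)%N.
  rewrite ltn_neqAle j'j andbT; apply: contra i'i => /eqP jE.
  by rewrite !xpair_eqE -!val_eqE /=; lia.
by apply: (wprim_kill _ pi'); lia.
Qed.

Lemma lef_family_inj u u' : lef_family u -> lef_family u' ->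
  lef_sum u = lef_sum u' -> forall i, u i = u' i.
Proof.
move=> fu fu' uu' i; apply/eqP; rewrite -subr_eq0 addrC -scaleN1r; apply/eqP.
apply: (lef_family_inj0 (u := fun i => -1 *: u' i + u i)).
  exact: lef_familyZD.
by rewrite lef_sumZD uu' scaleN1r addNr.
Qed.

Definition lef_single (i : lefI) x (i' : lefI) : Omega := if i' == i then x else 0.

Lemma lef_single_family i x : lef_ok i -> wprim i.1.1 i.1.2 x ->
  lef_family (lef_single i x).
Proof.
move=> iok px i'; rewrite /lef_single; case: eqP => [->|_]; last by split=> //; exact: wprim0.
by split=> //; rewrite iok.
Qed.

Lemma lef_single_sum i x : lef_sum (lef_single i x) = kap ^+ i.2 * x.
Proof.
rewrite /lef_sum (bigD1 i)//= big1 => [|i' /negbTE ni]; rewrite /lef_single.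
  by rewrite eqxx addr0.
by rewrite ni mulr0.
Qed.

Definition lef_index a b j : lefI := (inord a, inord b, inord j).

Lemma lef_indexE a b j : (a + b <= n)%N -> (j <= n - (a + b))%N ->
  [/\ (lef_index a b j).1.1 = a :> nat, (lef_index a b j).1.2 = b :> nat
    & (lef_index a b j).2 = j :> nat].
Proof. by move=> abn jn; rewrite /= !inordK//; lia. Qed.

Lemma lef_family_exists w : exists u, lef_family u /\ w = lef_sum u.
Proof.
move: w; apply: lefschetz_ind => [|w v [u [fu ->]] [u' [fu' ->]]|a b j x abn jn px].
- exists (fun=> 0); split; first by move=> i; split=> //; exact: wprim0.
  by rewrite /lef_sum big1// => i _; rewrite mulr0.
- exists (fun i => 1 *: u i + u' i); split; first exact: lef_familyZD.
  by rewrite lef_sumZD scale1r.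
- have [aE bE jE] := lef_indexE abn jn.
  exists (lef_single (lef_index a b j) x); split; last by rewrite lef_single_sum jE.
  by apply: lef_single_family; rewrite ?/lef_ok ?aE ?bE ?jE ?abn.
Qed.

Definition lef_parts w : lefI -> Omega := projT1 (cid (lef_family_exists w)).

Lemma lef_partsP w : lef_family (lef_parts w) /\ w = lef_sum (lef_parts w).
Proof. exact: (projT2 (cid (lef_family_exists w))). Qed.

Lemma lef_parts_uniq w u : lef_family u -> w = lef_sum u -> forall i, lef_parts w i = u i.
Proof.
move=> fu wE; have [fw wE'] := lef_partsP w.
by apply: lef_family_inj => //; rewrite -wE -wE'.
Qed.

Local Notation hcoef := (hcoef R[i] n).

(** The parts of a form in the Lefschetz decomposition are linear in it because
    they are unique, so the formula on the parts defines a linear map. *)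
Lemma hodge_exists : exists S, is_hodge K S.
Proof.
exists (fun w => \sum_(i : lefI) hcoef i.1.1 i.1.2 i.2 *:
   (kap ^+ (n - i.2 - (i.1.1 + i.1.2)) * lef_parts w i)); split.
  move=> z w v; have [fw wE] := lef_partsP w; have [fv vE] := lef_partsP v.
  rewrite scaler_sumr -big_split; apply: eq_bigr => i _ /=.
  rewrite (lef_parts_uniq (lef_familyZD z fw fv)) ?lef_sumZD -?wE -?vE//.
  by rewrite mulrDr scalerDr -scalerAr !scalerA mulrC.
move=> a b j w abn jn /(primitive_wprim _ abn) pw k.
have [aE bE jE] := lef_indexE abn jn.
rewrite !iter_lefschetz; set i := lef_index a b j in aE bE jE.
have pw' : wprim i.1.1 i.1.2 w by rewrite aE bE.
have iok : lef_ok i by rewrite /lef_ok aE bE jE abn.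
have lE := lef_parts_uniq (lef_single_family iok pw').
rewrite (bigD1 i)//= lE ?lef_single_sum ?jE// big1 => [|i' ni].
  rewrite /lef_single eqxx addr0 aE bE; congr (_ *: _).
  by rewrite phase_int.
by rewrite lE ?lef_single_sum ?jE// /lef_single (negbTE ni) mulr0 scaler0.
Qed.

Lemma hodgeP : is_hodge K (hodge K).
Proof. exact: xgetPex hodge_exists. Qed.

Lemma hodge_linear : linear (hodge K). Proof. by have [] := hodgeP. Qed.

Lemma hodge_kappaX a b j x : (a + b <= n)%N -> (j <= n - (a + b))%N -> wprim a b x ->
  hodge K (kap ^+ j * x) = hcoef a b j *: (kap ^+ (n - j - (a + b)) * x).
Proof.
move=> abn jn /(primitive_wprim _ abn) px; have [_ /(_ a b j x abn jn px)] := hodgeP.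
by cbv zeta; rewrite !iter_lefschetz phase_int => ->.
Qed.

End Lefschetz.

(** * The Hodge map and the local Kaehler identities *)

Section Hodge.
Variables (R : realType) (B Omega : algType R[i]) (sB : star_algebra B).
Variables (cal : calculus B Omega) (sC : star_calculus sB cal) (n : nat).
Hypothesis cal_degree : total_degree cal n.*2.
Variable K : kahler_structure n sC.
Implicit Types (w v x y : Omega) (a b c d e j k l : nat).

Local Notation kap := (kappa K).
Local Notation dB := (bform_direct K).
Local Notation hcoef := (hcoef R[i] n).
Local Notation wprim := (wprim K).

Definition hodge_fun : {linear Omega -> Omega} :=
  HB.pack (hodge K) (GRing.isLinear.Build _ _ _ _ _ (hodge_linear cal_degree K)).

Lemma hodgeD w v : hodge K (w + v) = hodge K w + hodge K v.
Proof. exact: (linearD hodge_fun). Qed.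
Lemma hodge0 : hodge K 0 = 0.
Proof. exact: (linear0 hodge_fun). Qed.
Lemma hodgeZ (z : R[i]) w : hodge K (z *: w) = z *: hodge K w.
Proof. exact: (linearZ_LR hodge_fun). Qed.

Lemma hodgeN w : hodge K (- w) = - hodge K w.
Proof. exact: (linearN hodge_fun). Qed.
Lemma hodgeB w v : hodge K (w - v) = hodge K w - hodge K v.
Proof. exact: (linearB hodge_fun). Qed.
Lemma hodge_sum (I : Type) (q : seq I) (u : I -> Omega) :
  hodge K (\sum_(i <- q) u i) = \sum_(i <- q) hodge K (u i).
Proof. exact: (linear_sum hodge_fun). Qed.

Lemma wprim_form a b j x : wprim a b x -> form cal (j.*2 + (a + b))%N (kap ^+ j * x).
Proof. by move=> [xb _]; apply: kappaX_form; exact: bform_form xb. Qed.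

Lemma parity_kappaX a b j x : wprim a b x ->
  parity cal (kap ^+ j * x) = (-1) ^+ (a + b) *: (kap ^+ j * x).
Proof.
move=> px; rewrite (parity_form (wprim_form j px)) -[in LHS]signr_odd oddD odd_double.
rewrite -[in RHS]signr_odd /=.
by case: odd; rewrite ?scaleN1r ?scale1r ?mulN1r ?mul1r.
Qed.

Lemma wprim_incl a b x (r : B) : wprim a b x -> wprim a b (x * incl cal r).
Proof.
move=> [xb x0]; split; last by rewrite mulrA x0 mul0r.
by rewrite -[a]addn0 -[b]addn0; apply: bform_mul => //; exact: incl_bform.
Qed.

Lemma star_kappaX j w : sC (kap ^+ j * w) = kap ^+ j * sC w.
Proof.
have star_kappa x : sC (kap * x) = kap * sC x.
  move: x; apply: (form_ind (cal := cal)) => [|x y E E'|k x kx].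
  - by rewrite !(mulr0, star0).
  - by rewrite mulrDr !starD E E' mulrDr.
  - rewrite (fstarM sC (bform_form (kappa11 K)) kx) kappa_real -kappa_central.
    by rewrite exprM sqrrN !expr1n mul1r.
by elim: j => [|j IHj]; rewrite ?mul1r// exprS -!mulrA star_kappa IHj.
Qed.

Lemma wprim_star a b x : wprim a b x -> wprim b a (sC x).
Proof.
move=> [xb x0]; split; first exact: bform_starr.
by rewrite addnC -star_kappaX x0 star0.
Qed.

Lemma hodge_form l w : form cal l w -> form cal (n.*2 - l)%N (hodge K w).
Proof.
have fD := form_direct cal.
move=> lw; rewrite -(component_id fD lw); move: w {lw}.
apply: (lefschetz_ind cal_degree (K := K)) => [|w v E E'|a b j x abn jn px].
- by rewrite (component0 fD) hodge0; exact: (grade0 fD).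
- by rewrite (componentD fD) hodgeD; exact: (gradeD fD).
rewrite (component_of fD _ (wprim_form j px)); case: eqP => [->|_].
  rewrite (hodge_kappaX cal_degree abn jn px); apply: (gradeZ fD).
  rewrite (_ : (n.*2 - _ = (n - j - (a + b)).*2 + (a + b))%N); last by lia.
  exact: wprim_form.
by rewrite hodge0; exact: (grade0 fD).
Qed.

Lemma hodgeK w : hodge K (hodge K w) = parity cal w.
Proof.
move: w; apply: (lefschetz_ind cal_degree (K := K)) => [|w v E E'|a b j x abn jn px].
- by rewrite !hodge0 parity0.
- by rewrite !hodgeD E E' parityD.
rewrite (hodge_kappaX cal_degree abn jn px) hodgeZ (hodge_kappaX cal_degree abn _ px).
  rewrite scalerA hcoef_sqr// (parity_kappaX _ px).
  by rewrite (_ : (n - (n - j - (a + b)) - (a + b) = j)%N); last by lia.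
by lia.
Qed.

Lemma hodge_parity w : hodge K (parity cal w) = parity cal (hodge K w).
Proof. by rewrite -!hodgeK. Qed.

Lemma hodge_star w : hodge K (sC w) = sC (hodge K w).
Proof.
move: w; apply: (lefschetz_ind cal_degree (K := K)) => [|w v E E'|a b j x abn jn px].
- by rewrite star0 hodge0 star0.
- by rewrite starD !hodgeD starD E E'.
have [ban jn'] : (b + a <= n)%N /\ (j <= n - (b + a))%N by rewrite [(b + a)%N]addnC.
rewrite star_kappaX (hodge_kappaX cal_degree abn jn px).
rewrite (hodge_kappaX cal_degree ban jn' (wprim_star px)).
by rewrite starZ hcoef_conj star_kappaX [(a + b)%N]addnC.
Qed.

Lemma hodge_incl w (r : B) : hodge K (w * incl cal r) = hodge K w * incl cal r.
Proof.
move: w; apply: (lefschetz_ind cal_degree (K := K)) => [|w v E E'|a b j x abn jn px].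
- by rewrite !(mul0r, hodge0).
- by rewrite !(mulrDl, hodgeD) E E'.
rewrite -mulrA (hodge_kappaX cal_degree abn jn px).
by rewrite (hodge_kappaX cal_degree abn jn (wprim_incl r px)) -scalerAl mulrA.
Qed.

Lemma dual_lefschetzE w :
  dual_lefschetz K w = parity cal (hodge K (kap * hodge K w)).
Proof.
apply: xget_unique => [|u /=].
  by rewrite /lefschetz /= hodge_parity hodgeK parityK.
by rewrite /lefschetz => <-; rewrite hodgeK parityK.
Qed.

Lemma dual_lefschetzD w v :
  dual_lefschetz K (w + v) = dual_lefschetz K w + dual_lefschetz K v.
Proof. by rewrite !dual_lefschetzE hodgeD mulrDr hodgeD parityD. Qed.

Lemma dual_lefschetz0 : dual_lefschetz K 0 = 0.
Proof. by rewrite dual_lefschetzE hodge0 mulr0 hodge0 parity0. Qed.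

Lemma dual_lefschetzZ (z : R[i]) w : dual_lefschetz K (z *: w) = z *: dual_lefschetz K w.
Proof. by rewrite !dual_lefschetzE hodgeZ -scalerAr hodgeZ parityZ. Qed.

Lemma dual_lefschetz_linear : linear (dual_lefschetz K).
Proof. by move=> z w v; rewrite dual_lefschetzD dual_lefschetzZ. Qed.

Definition dual_lefschetz_fun : {linear Omega -> Omega} :=
  HB.pack (dual_lefschetz K) (GRing.isLinear.Build _ _ _ _ _ dual_lefschetz_linear).

Lemma dual_lefschetzB w v :
  dual_lefschetz K (w - v) = dual_lefschetz K w - dual_lefschetz K v.
Proof. exact: (linearB dual_lefschetz_fun). Qed.

Lemma dual_lefschetz_sum (I : Type) (q : seq I) (u : I -> Omega) :
  dual_lefschetz K (\sum_(i <- q) u i) = \sum_(i <- q) dual_lefschetz K (u i).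
Proof. exact: (linear_sum dual_lefschetz_fun). Qed.

Lemma dual_lefschetz_incl w (r : B) :
  dual_lefschetz K (w * incl cal r) = dual_lefschetz K w * incl cal r.
Proof. by rewrite !dual_lefschetzE hodge_incl mulrA hodge_incl parityM parity_incl. Qed.

(** This is the sl2 relation for the lowering operator.  With truncated
    subtraction the formula covers the cases where L^j x or its image is 0. *)
Lemma dual_lefschetz_kappaX a b j x : (a + b <= n.+1)%N -> wprim a b x ->
  dual_lefschetz K (kap ^+ j * x) =
  (j * (n.+1 - (a + b) - j))%:R *: (kap ^+ j.-1 * x).
Proof.
move=> abn px.
have [nj|jn] := ltnP n (a + b + j).
  rewrite (wprim_kill nj px) dual_lefschetz0.
  by rewrite (_ : (n.+1 - (a + b) - j = 0)%N) ?muln0 ?scale0r//; lia.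
have abn' : (a + b <= n)%N by lia.
rewrite dual_lefschetzE (hodge_kappaX cal_degree abn' _ px); last by lia.
rewrite -scalerAr hodgeZ mulrA -exprS parityZ.
case: j jn => [|j] jn.
  rewrite mul0n scale0r (wprim_kill _ px) ?hodge0 ?parity0 ?scaler0//; lia.
rewrite (_ : (n - j.+1 - (a + b)).+1 = (n - j - (a + b))%N); last by lia.
rewrite (hodge_kappaX cal_degree abn' _ px); last by lia.
rewrite (_ : (n - (n - j - (a + b)) - (a + b) = j)%N); last by lia.
rewrite (hcoefS R[i]); last by lia.
rewrite parityZ scalerA -mulrA hcoef_sqr; last by lia.
rewrite (parity_kappaX _ px) scalerA -mulrA -expr2 sqrr_sign mulr1.
by rewrite (_ : (n.+1 - (a + b) - j.+1 = n - j - (a + b))%N); last by lia.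
Qed.

(** Let x be primitive of degree k.  As D commutes with L, the form D x is killed
    by L^(n + 1 - k), so D x = x0 + L v with x0 and v primitive of degrees k + 1
    and k - 1.  Both sides can then be computed on L^j x: with
    e = n - j - k they are - j L^(j - 1) x0 + (e + 1) L^j v.  The statement does
    not ask D to be a derivation, hence applies also to the multiplication by a
    1-form. *)
Lemma local_kahler_identity (D : {linear Omega -> Omega}) c d :
  (c + d = 1)%N -> bidegree K c d D -> (forall w, D (kap * w) = kap * D w) ->
  forall w, dual_lefschetz K (D w) - D (dual_lefschetz K w) =
            - (phase R[i] c d *: hodge K (D (hodge K w))).
Proof.
move=> cd bD Dk; have DkX j w : D (kap ^+ j * w) = kap ^+ j * D w.
  by elim: j => [|j IHj]; rewrite ?mul1r// exprS -!mulrA Dk IHj.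
apply: (lefschetz_ind cal_degree (K := K)) => [|w v E E'|a b j x abn jn px].
- by rewrite hodge0 linear0 hodge0 dual_lefschetz0 linear0 scaler0 subr0 oppr0.
- rewrite hodgeD !linearD hodgeD !dual_lefschetzD linearD scalerDr [in RHS]opprD.
  by rewrite -E -E' opprD addrACA.
have [xb _] := px.
have [|v [px0 vE]] := primitive_split cal_degree _ (bD _ _ _ xb); first by lia.
set x0 := D x - kap * v in px0.
have DxE : D x = x0 + kap * v by rewrite subrK.
clearbody x0.
set e := (n - j - (a + b))%N.
have dual_x0 : dual_lefschetz K (kap ^+ j * x0) = (j * e)%:R *: (kap ^+ j.-1 * x0).
  by rewrite (dual_lefschetz_kappaX _ _ px0) /e; [congr (_%:R *: _); nia|lia].
(* For j = 0 the Hodge formula does not apply to L^e x0, but this form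
   vanishes since x0 has degree one more than x. *)
have hodge_x0 : phase R[i] c d *: (hcoef a b j *: hodge K (kap ^+ e * x0)) =
    j%:R *: (kap ^+ j.-1 * x0).
  case: (posnP j) => [j0|j0].
    by rewrite (wprim_kill _ px0) ?hodge0 ?scaler0 ?j0 ?scale0r// /e j0; lia.
  rewrite (hodge_kappaX cal_degree _ _ px0); [|by rewrite /e; lia..].
  rewrite 2!scalerA -[X in X *: _]mulrA hcoef_up//.
  by congr (_ *: (kap ^+ _ * _)); rewrite /e; lia.
have kapv : kap ^+ j.+1 * v = kap ^+ j * (kap * v) by rewrite exprSr mulrA.
have [dual_v hodge_v] :
    dual_lefschetz K (kap ^+ j * (kap * v)) = (j.+1 * e.+1)%:R *: (kap ^+ j * v) /\
    phase R[i] c d *: (hcoef a b j *: hodge K (kap ^+ e * (kap * v))) =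
    - (e.+1%:R *: (kap ^+ j * v)).
  have [->|[a' [b' [aE bE vb]]]] := vE.
    by rewrite !mulr0 dual_lefschetz0 hodge0 !scaler0 oppr0.
  have pv : wprim a' b' v.
    split=> //; rewrite (_ : (n.+1 - (a' + b') = (n.+1 - (a + b)).+1)%N); last by lia.
    have kv : kap * v = D x - x0 by rewrite DxE addrC addKr.
    rewrite exprSr -mulrA kv mulrBr -DkX (wprim_kill _ px) ?linear0; last by lia.
    by rewrite (wprim_kill _ px0) ?subrr//; lia.
  have kXkv i : kap ^+ i * (kap * v) = kap ^+ i.+1 * v by rewrite exprSr mulrA.
  rewrite !kXkv (dual_lefschetz_kappaX _ _ pv); last by lia.
  rewrite (hodge_kappaX cal_degree _ _ pv); [|by rewrite /e; lia..].
  split; first by congr (_%:R *: _); rewrite /e; nia.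
  rewrite 2!scalerA -[X in X *: _]mulrA hcoef_down//.
  rewrite scaleNr; congr (- (_ *: (kap ^+ _ * _))); rewrite /e; lia.
rewrite DkX DxE mulrDr dual_lefschetzD dual_x0 dual_v.
rewrite (dual_lefschetz_kappaX _ _ px); last by lia.
rewrite (_ : (n.+1 - (a + b) - j = e.+1)%N); last by rewrite /e; lia.
rewrite (hodge_kappaX cal_degree abn jn px) -/e !(linearZ_LR D) /= !DkX DxE !mulrDr.
rewrite hodgeZ hodgeD !scalerDr hodge_x0 hodge_v.
have kXv : j%:R *: (kap ^+ j.-1 * (kap * v)) = j%:R *: (kap ^+ j * v).
  by case: (j) => [|i]; rewrite ?scale0r// exprSr mulrA.
have -> : (j * e.+1)%:R *: (kap ^+ j.-1 * (kap * v)) = (j * e.+1)%:R *: (kap ^+ j * v).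
  by rewrite mulnC natrM -!scalerA kXv.
rewrite mulSn [(j * e.+1)%N in X in _ - (X + _)]mulnS !natrD !scalerDl addrA.
have zmod_id (p q r t : Omega) : p + q + r - (t + p + r) = q - t.
  by rewrite opprD addrACA subrr addr0 [p + q]addrC [t + p]addrC opprD addrA addrK.
by rewrite opprB; exact: zmod_id.
Qed.

End Hodge.

(** * The integral and the metric on forms *)

Section Pairing.
Variables (R : realType) (B Omega : algType R[i]) (sB : star_algebra B).
Variables (cal : calculus B Omega) (sC : star_calculus sB cal) (n : nat).
Hypothesis cal_degree : total_degree cal n.*2.
Variable K : kahler_structure n sC.
Variable st : {scalar B}.
Implicit Types (w v x y : Omega) (a b c d e j k l : nat).

Local Notation fD := (form_direct cal).

Lemma to_base_incl (r : B) : to_base cal (incl cal r) = r.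
Proof. by apply: xget_unique => //= r' /incl_inj. Qed.

Lemma to_baseK x : form cal 0 x -> incl cal (to_base cal x) = x.
Proof. by rewrite form0E => -[r _ <-]; rewrite to_base_incl. Qed.

Lemma to_baseD x y : form cal 0 x -> form cal 0 y ->
  to_base cal (x + y) = to_base cal x + to_base cal y.
Proof.
move=> x0 y0; apply: (@incl_inj _ _ _ cal); rewrite rmorphD /= !to_baseK//.
exact: gradeD fD _ _ _ x0 y0.
Qed.

Lemma to_base0 : to_base cal 0 = 0.
Proof. by rewrite -(to_base_incl 0) rmorph0. Qed.

(** The integral is extended by zero to all degrees, as the component of degree 0
    of the Hodge dual is dual to the component of degree 2n. *)
Definition integral w : R[i] := st (to_base cal (component (form cal) 0%N (hodge K w))).

Lemma integralD w v : integral (w + v) = integral w + integral v.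
Proof.
rewrite /integral hodgeD// (componentD fD) to_baseD ?linearD//; exact: component_grade fD _ _.
Qed.

Lemma integral0 : integral 0 = 0.
Proof. by rewrite /integral hodge0// (component0 fD) to_base0 linear0. Qed.

Lemma integralN w : integral (- w) = - integral w.
Proof. by apply: (addrI (integral w)); rewrite -integralD !subrr integral0. Qed.

Lemma integral_form k w : k != n.*2 -> form cal k w -> integral w = 0.
Proof.
move=> kn kw; have [nk|kn'] := ltnP n.*2 k.
  by rewrite (form_over cal_degree nk kw) integral0.
rewrite /integral (component_neq fD (hodge_form cal_degree K kw)) ?to_base0 ?linear0//.
by lia.
Qed.

Lemma integral_top w : form cal n.*2 w -> integral w = st (to_base cal (hodge K w)).
Proof.
move=> tw; rewrite /integral (component_id fD)//.
by have := hodge_form cal_degree K tw; rewrite subnn.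
Qed.

Lemma integral_parity w : integral (parity cal w) = integral w.
Proof.
move: w; apply: (form_ind (cal := cal)) => [|w v E E'|k w kw].
- by rewrite parity0.
- by rewrite parityD !integralD E E'.
have [kE|kn] := eqVneq k n.*2.
  by rewrite (parity_form kw) kE -signr_odd odd_double mul1r.
by rewrite (integral_form kn kw) (integral_form kn (form_parity kw)).
Qed.

Lemma metricE w v : metric K w v = \sum_(k < n.*2.+1) to_base cal (component (form cal) 0%N
  (hodge K (component (form cal) k w * sC (hodge K (component (form cal) k v))))).
Proof.
rewrite /metric (@fsum_seq _ _ (index_iota 0 n.*2.+1)) ?iota_uniq ?big_mkord// => [|k].
  apply: eq_bigr => k _; rewrite hodge_star// (component_id fD (i := 0%N))//.
  have kf u : form cal k (component (form cal) k u) by exact: component_grade fD _ _.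
  have := hodge_form cal_degree K (form_mul (kf w) (form_star K (hodge_form cal_degree K (kf v)))).
  by rewrite subnKC ?subnn //; have := ltn_ord k; rewrite ltnS.
rewrite mem_index_iota /= -leqNgt => nk.
rewrite (form_over cal_degree nk (component_grade fD k w)) mul0r hodge0//.
exact: to_base0.
Qed.

(** The product of forms of different degrees k and l has degree k + 2n - l, where
    the integral vanishes; hence the metric, defined degree by degree, has an
    expression free of components. *)
Lemma metric_integral w v : st (metric K w v) = integral (w * sC (hodge K v)).
Proof.
rewrite metricE; move: w; apply: (form_ind (cal := cal)) => [|w w' E E'|k w kw].
- rewrite mul0r integral0 big1 ?linear0// => k _.
  by rewrite (component0 fD) mul0r hodge0// (component0 fD) to_base0.
- rewrite mulrDl integralD -E -E' -linearD -big_split; congr (st _).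
  apply: eq_bigr => k _ /=; rewrite (componentD fD) mulrDl hodgeD// (componentD fD).
  by rewrite to_baseD//; exact: component_grade fD _ _.
move: v; apply: (form_ind (cal := cal)) => [|v v' E E'|l v lv].
- rewrite hodge0// star0 mulr0 integral0 big1 ?linear0// => l _.
  by rewrite (component0 fD) hodge0// star0 mulr0 hodge0// (component0 fD) to_base0.
- rewrite hodgeD// starD mulrDr integralD -E -E' -linearD -big_split; congr (st _).
  apply: eq_bigr => l _ /=; rewrite (componentD fD) hodgeD// starD mulrDr hodgeD//.
  by rewrite (componentD fD) to_baseD//; exact: component_grade fD _ _.
have [nk|kn] := ltnP n.*2 k.
  rewrite (form_over cal_degree nk kw) mul0r integral0 big1 ?linear0// => j _.
  by rewrite (component0 fD) mul0r hodge0// (component0 fD) to_base0.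
have kn' : (k < n.*2.+1)%N by [].
rewrite (bigD1 (Ordinal kn'))//= big1 ?addr0 => [|j]; last first.
  rewrite -val_eqE /= => jk.
  by rewrite (component_neq fD kw)// mul0r hodge0// (component0 fD) to_base0.
rewrite (component_id fD kw) (component_of fD _ lv); case: eqP => // kl.
rewrite hodge0// star0 mulr0 hodge0// (component0 fD) to_base0 linear0.
have [nl|ln] := ltnP n.*2 l.
  by rewrite (form_over cal_degree nl lv) hodge0// star0 mulr0 integral0.
rewrite (integral_form _ (form_mul kw (form_star K (hodge_form cal_degree K lv))))//; lia.
Qed.

Lemma integral_pairingB w v v' : integral (w * sC (hodge K (v - v'))) =
  integral (w * sC (hodge K v)) - integral (w * sC (hodge K v')).
Proof. by rewrite hodgeB// starD starN mulrBr integralD integralN. Qed.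

Lemma integral_pairing_sum (I : Type) (q : seq I) w (u : I -> Omega) :
  integral (w * sC (hodge K (\sum_(i <- q) u i))) =
  \sum_(i <- q) integral (w * sC (hodge K (u i))).
Proof.
rewrite hodge_sum// (big_morph sC (starD sC) (star0 sC)) mulr_sumr.
exact: (big_morph integral integralD integral0).
Qed.

Lemma metricDl w w' v : metric K (w + w') v = metric K w v + metric K w' v.
Proof.
rewrite !metricE -big_split; apply: eq_bigr => k _ /=.
rewrite (componentD fD) mulrDl hodgeD// (componentD fD).
by rewrite to_baseD//; exact: component_grade fD _ _.
Qed.

Lemma metricDr w v v' : metric K w (v + v') = metric K w v + metric K w v'.
Proof.
rewrite !metricE -big_split; apply: eq_bigr => k _ /=.
rewrite (componentD fD) hodgeD// starD mulrDr hodgeD//.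
by rewrite (componentD fD) to_baseD//; exact: component_grade fD _ _.
Qed.

Lemma component_incl k w (r : B) :
  component (form cal) k (w * incl cal r) = component (form cal) k w * incl cal r.
Proof.
move: w; apply: (form_ind (cal := cal)) => [|w w' E E'|l w lw].
- by rewrite mul0r (component0 fD) mul0r.
- by rewrite mulrDl !(componentD fD) E E' mulrDl.
have := form_mul lw (incl_form cal r); rewrite addn0 => lwr.
by rewrite (component_of fD _ lw) (component_of fD _ lwr); case: ifP; rewrite ?mul0r.
Qed.

Lemma metric_inclA w v (r : B) :
  metric K (w * incl cal r) v = metric K w (v * incl cal (sB r)).
Proof.
rewrite !metricE; apply: eq_bigr => k _; rewrite !component_incl hodge_incl//.
congr (to_base cal (component _ _ (hodge K _))); rewrite -mulrA; congr (_ * _).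
set x := hodge K _; have kx : form cal (n.*2 - k)%N x.
  by apply: hodge_form => //; exact: component_grade fD _ _.
rewrite (fstarM sC kx (incl_form cal _)) muln0 mul1r fstar_incl.
by rewrite bstarK.
Qed.

Hypothesis st_state : is_state sB st.
Hypothesis K_pos : positive_definite K.
Hypothesis K_closed : closed_integral K st.

(** If v is not 0 the metric of v with itself is a non-zero sum of squares, on
    which the state is positive. *)
Lemma integral_nondegenerate v :
  (forall w, integral (w * sC (hodge K v)) = 0) -> v = 0.
Proof.
move=> v0; apply: contrapT => /K_pos [g0 [m [l [c [lpos gE]]]]].
have := v0 v; rewrite -metric_integral gE linear_sum /= => /eqP.
have stp r : 0 <= st (sB r * r).
  by have [->|/eqP/st_state/ltW//] := eqVneq r 0; rewrite mulr0 linear0.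
rewrite psumr_eq0 => [/allP sum0|i _]; last first.
  by rewrite linearZ /= mulr_ge0// ltW.
apply: g0; rewrite gE big1// => i _; have := sum0 i (mem_index_enum i).
rewrite linearZ /= mulf_eq0 gt_eqF//= => /eqP.
have [->|/eqP/st_state] := eqVneq (c i) 0; first by rewrite mulr0 scaler0.
by move=> + E; rewrite E ltxx.
Qed.

(** Forms of top degree are kappa^n b with b in the algebra. *)
Lemma top_bidegree a b w : (a + b = n.*2)%N -> a != n -> bform K a b w -> w = 0.
Proof.
move=> abn an abw; have := bform_form abw; rewrite abn => tw.
have [||v v0 wE] := @kappaX_surj _ _ _ _ _ _ _ K 0 w; rewrite ?subn0//.
move: v0; rewrite form0E => -[r _ vE]; move: wE; rewrite subn0 -vE => wE.
have := kappaX_bidegree n (incl_bform K r); rewrite wE add0n.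
by move=> /bpart_bform => /(_ a b); rewrite (negbTE an) (bpart_id abw).
Qed.

Section Adjoints.
Variables (d1 d2 : nat) (D D' : {linear Omega -> Omega}).
Hypothesis DD' : dolbeault K d1 d2 D D'.

(** Only bidegree (n, n) contributes to the integral; if D w has this bidegree,
    then D' w has another one and the same degree, hence vanishes, and D w is the
    differential of w. *)
Lemma integral_exact w : integral (D w) = 0.
Proof.
have [d12 bD bD' difE] := DD'.
move: w; apply: (bform_ind (cs := K)) => [|w v E E'|a b w abw].
- by rewrite linear0 integral0.
- by rewrite linearD integralD E E' addr0.
have Dw := bD _ _ _ abw; have D'w := bD' _ _ _ abw.
have abE : (a + d1 + (b + d2) = (a + b).+1)%N by lia.
have [abn|abn] := eqVneq (a + b).+1 n.*2; last first.
  by apply: integral_form (bform_form Dw); rewrite abE.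
have [an|an] := eqVneq (a + d1)%N n; last first.
  by rewrite (top_bidegree _ an Dw) ?integral0//; lia.
have D'0 : D' w = 0 by apply: (top_bidegree _ _ D'w); lia.
have := K_closed abn (bform_form abw); rewrite difE D'0 addr0 -integral_top//.
by have := bform_form Dw; rewrite abE abn.
Qed.

End Adjoints.

Lemma integral_parityr w v : integral (w * parity cal v) = integral (parity cal w * v).
Proof. by rewrite -integral_parity parityM parityK. Qed.

(** Stokes: the integral of D' (w (hodge v)^* ) vanishes.  The outer Hodge map is
    cancelled by the one in the pairing, up to a sign. *)
Lemma integral_adjoint d1 d2 (D D' : {linear Omega -> Omega}) w v :
  dolbeault K d1 d2 D D' ->
  integral (D' w * sC (hodge K v)) =
  - integral (w * sC (hodge K (hodge K (D (hodge K v))))).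
Proof.
move=> DD'; have D'D := dolbeault_sym DD'.
have := integral_exact D'D (w * sC (hodge K v)).
rewrite (dolbeaultM D'D) integralD -(dolbeault_star DD') => /eqP.
rewrite addr_eq0 => /eqP ->; congr (- _).
by rewrite hodgeK// -(parity_star K) integral_parityr.
Qed.

(** The analogue of integral_adjoint for the multiplication by a 1-form, with the
    opposite sign: no integration by parts takes place. *)
Lemma integral_adjoint_rmul x w v : form cal 1 x ->
  integral (rmul_parity cal x w * sC (hodge K v)) =
  integral (w * sC (hodge K (hodge K (rmul_parity cal (sC x) (hodge K v))))).
Proof.
move=> x1; rewrite hodgeK// -(parity_star K) integral_parityr /rmul_parity -mulrA.
congr (integral (_ * _)); move: (hodge K v) => {w v}w.
move: w; apply: (form_ind (cal := cal)) => [|w v E E'|k w kw].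
- by rewrite parity0 mul0r star0 mulr0.
- by rewrite parityD mulrDl !starD mulrDr E E'.
rewrite (fstarM sC (form_parity kw) (form_star K x1)) fstarK -(parity_star K) muln1.
by rewrite (parity_form (form_star K kw)) !signmE; case: odd; rewrite ?mulrN ?opprK.
Qed.

End Pairing.

(** * Laplacians from the Kaehler identities *)

Section LinearAlgebra.
Variables (C : numClosedFieldType) (V : lmodType C) (E E' L A A' : {linear V -> V}).
Hypothesis EE : forall t, E (E t) = 0.
Hypothesis E'E' : forall t, E' (E' t) = 0.
Hypothesis AE : forall t, A t = 'i *: (L (E' t) - E' (L t)).
Hypothesis A'E : forall t, A' t = - 'i *: (L (E t) - E (L t)).

Lemma cross_terms t : E (A' t) + A' (E t) = 0 /\ E' (A t) + A (E' t) = 0.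
Proof.
rewrite !AE !A'E !linearZ_LR !linearB /= !EE !E'E' !(linear0 L).
by rewrite !scaler0 !subr0 !sub0r !scaleNr opprK addNr subrr.
Qed.

Lemma laplacian_difference t : E (A t) + A (E t) =
  E' (A' t) + A' (E' t) +
  (L ('i *: (E (E' t) + E' (E t))) - 'i *: (E (E' (L t)) + E' (E (L t)))).
Proof.
rewrite !AE !A'E !linearZ_LR !linearB linearD /= !scaleNr !opprK !scalerDr opprD !scalerDr !scalerN.
rewrite [RHS](AC ((2*2)*(2*2)) ((4*7)*(6*1)*((8*2)*(3*5)))) /=.
by rewrite !addNr !addr0.
Qed.

Hypothesis AA : forall t, A (A t) = 0.
Hypothesis A'A' : forall t, A' (A' t) = 0.

(** Here E and E' play the roles of the two parts of the connection and A, A' those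
    of their adjoints, which are given by the Kaehler identities.  Since E and E'
    square to zero, the cross terms of the first Laplacian cancel and each of the
    other two is a combination of words in E, E' and one L; their difference is
    the bracket of L with the curvature E E' + E' E. *)
Lemma nakano_identity t (N := fun t => E t + E' t) (A2 := fun t => A t + A' t)
    (D1 := iter 2 (fun t => E t + A t) t) (D2 := iter 2 (fun t => E' t + A' t) t)
    (Br := L ('i *: N (N t)) - 'i *: N (N (L t))) :
  [/\ N (A2 t) + A2 (N t) = D1 + D2,
      N (A2 t) + A2 (N t) = 2 *: D1 - Br
    & N (A2 t) + A2 (N t) = 2 *: D2 + Br].
Proof.
have D1E : D1 = E (A t) + A (E t) by rewrite /D1 /= (linearD E) (linearD A) EE AA add0r addr0.
have D2E : D2 = E' (A' t) + A' (E' t).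
  by rewrite /D2 /= (linearD E') (linearD A') E'E' A'A' add0r addr0.
have BrE : Br = L ('i *: (E (E' t) + E' (E t))) - 'i *: (E (E' (L t)) + E' (E (L t))).
  by rewrite /Br /N !(linearD E) !(linearD E') !EE !E'E' !add0r !addr0.
have D12 : D1 = D2 + Br by rewrite D1E D2E BrE laplacian_difference.
have D0 : N (A2 t) + A2 (N t) = D1 + D2.
  have [c1 c2] := cross_terms t.
  rewrite D1E D2E /N /A2 !(linearD E) !(linearD E') !(linearD A) !(linearD A').
  rewrite [LHS](AC ((2*2)*(2*2)) ((1*5)*(4*8)*((3*6)*(2*7)))) /=.
  by rewrite c1 c2 !addr0.
clearbody D1 D2 Br; split=> //; rewrite D0 scaler_nat mulr2n.
  by rewrite -addrA; congr (_ + _); rewrite D12 addrK.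
by rewrite D12 addrAC.
Qed.

End LinearAlgebra.

(** * Forms with values in a module *)

Section Tensor.
Variables (R : realType) (B Omega : algType R[i]) (sB : star_algebra B).
Variables (cal : calculus B Omega) (sC : star_calculus sB cal) (n : nat).
Hypothesis cal_degree : total_degree cal n.*2.
Variable K : kahler_structure n sC.
Variables (F : lmodType B) (F_fgp : fg_projective F) (h : hermitian_structure sB F).
Implicit Types (w v x y : Omega) (f g k : F) (r : B).

Local Notation T := (tensor cal F).
Implicit Types (s t : T).
Local Notation tens := (@Defs.tens R B Omega cal F).

Lemma pi_tensor_sum (q : seq (Omega * F)) :
  \pi_T q = \sum_(p <- q) tens p.1 p.2 :> T.
Proof.
elim: q => [|[w f] q IHq]; first by rewrite big_nil.
by rewrite big_cons -IHq -cat1s -tensor_pi_add.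
Qed.

Lemma tens_ind (P : T -> Prop) : P 0 -> (forall s t, P s -> P t -> P (s + t)) ->
  (forall w f, P (tens w f)) -> forall t, P t.
Proof.
move=> P0 PD Pt; elim/tensor_ind => q; rewrite pi_tensor_sum.
by elim/big_rec: _ => // p t _; exact: PD.
Qed.

Lemma tensDl w v f : tens (w + v) f = tens w f + tens v f.
Proof.
rewrite /Defs.tens [RHS]tensor_pi_add; exact/tensor_piP/tensor_eqDl.
Qed.

Lemma tensDr w f g : tens w (f + g) = tens w f + tens w g.
Proof.
rewrite /Defs.tens [RHS]tensor_pi_add; exact/tensor_piP/tensor_eqDr.
Qed.

Lemma tens0l f : tens 0 f = 0.
Proof. exact/tensor_piP/tensor_eq0. Qed.

Lemma tensNl w f : tens (- w) f = - tens w f.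
Proof. by rewrite -[in LHS]scaleN1r -scale_tens scaleN1r. Qed.

Lemma tens_inclM w r f : tens (w * incl cal r) f = tens w (r *: f).
Proof. exact/tensor_piP/tensor_eqM. Qed.

Lemma tens0r w : tens w 0 = 0.
Proof. by rewrite -(scale0r (0 : F)) -tens_inclM rmorph0 mulr0 tens0l. Qed.

Lemma tens_sumr w (I : Type) (q : seq I) (z : I -> F) :
  tens w (\sum_(i <- q) z i) = \sum_(i <- q) tens w (z i).
Proof. exact: (big_morph (tens w) (tensDr w) (tens0r w)). Qed.

Lemma tlift0 (V : nmodType) (phi : Omega -> F -> V) :
  balanced cal phi -> tlift phi (0 : T) = 0.
Proof. by move=> bphi; have := tlift_pi [::] bphi; rewrite big_nil. Qed.

Lemma balancedZ (V : lmodType R[i]) (phi : Omega -> F -> V) z t : balanced cal phi ->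
  (forall w f, phi (z *: w) f = z *: phi w f) -> tlift phi (z *: t) = z *: tlift phi t.
Proof.
move=> bphi phiZ; move: t; apply: tens_ind => [|s t E E'|w f].
- by rewrite scaler0 tlift0 ?scaler0.
- by rewrite scalerDr !tliftD// E E' scalerDr.
- by rewrite scale_tens !tlift_tens.
Qed.

Lemma wedge_balanced w : balanced cal (fun v f => tens (w * v) f).
Proof.
split=> [v v' f|v f g|f|v r f].
- by rewrite mulrDr tensDl.
- exact: tensDr.
- by rewrite mulr0 tens0l.
- by rewrite mulrA tens_inclM.
Qed.

Lemma wedge_tens w v f : wedge w (tens v f) = tens (w * v) f.
Proof. exact/tlift_tens/wedge_balanced. Qed.

Lemma wedgeDr w s t : wedge w (s + t) = wedge w s + wedge w t.
Proof. exact/tliftD/wedge_balanced. Qed.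

Lemma wedge0r w : wedge w (0 : T) = 0.
Proof. exact/tlift0/wedge_balanced. Qed.

Lemma wedgeDl w v t : wedge (w + v) t = wedge w t + wedge v t.
Proof.
move: t; apply: tens_ind => [|s t E E'|x f].
- by rewrite !wedge0r addr0.
- by rewrite !wedgeDr E E' addrACA.
- by rewrite !wedge_tens mulrDl tensDl.
Qed.

Lemma wedgeA w v t : wedge w (wedge v t) = wedge (w * v) t.
Proof.
move: t; apply: tens_ind => [|s t E E'|x f].
- by rewrite !wedge0r.
- by rewrite !wedgeDr E E'.
- by rewrite !wedge_tens mulrA.
Qed.

Lemma wedge0l t : wedge 0 t = 0.
Proof.
move: t; apply: tens_ind => [|s t E E'|x f].
- by rewrite !wedge0r.
- by rewrite !wedgeDr E E' addr0.
- by rewrite wedge_tens mul0r tens0l.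
Qed.

Lemma wedgeZ (z : R[i]) w t : wedge (z *: w) t = z *: wedge w t.
Proof.
move: t; apply: tens_ind => [|s t E E'|x f].
- by rewrite !wedge0r scaler0.
- by rewrite !wedgeDr E E' scalerDr.
- by rewrite !wedge_tens scale_tens scalerAl.
Qed.

Lemma wedgeNr w t : wedge w (- t) = - wedge w t.
Proof. by apply: (addrI (wedge w t)); rewrite -wedgeDr !subrr wedge0r. Qed.

Definition right_linear (phi : Omega -> Omega) :=
  (forall w v, phi (w + v) = phi w + phi v) /\
  (forall w r, phi (w * incl cal r) = phi w * incl cal r).

Section TensorMap.
Variable phi : Omega -> Omega.
Hypothesis phiL : right_linear phi.

Lemma right_linear0 : phi 0 = 0.
Proof. by have [phiD _] := phiL; apply: (addIr (phi 0)); rewrite -phiD !add0r. Qed.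

Lemma tensor_map_balanced : balanced cal (fun w f => tens (phi w) f).
Proof.
have [phiD phiM] := phiL; split=> [v v' f|v f g|f|v r f].
- by rewrite phiD tensDl.
- exact: tensDr.
- by rewrite right_linear0 tens0l.
- by rewrite phiM tens_inclM.
Qed.

Lemma tensor_map_tens w f : tensor_map phi (tens w f) = tens (phi w) f.
Proof. exact/tlift_tens/tensor_map_balanced. Qed.

Lemma tensor_mapD s t : tensor_map phi (s + t) = tensor_map phi s + tensor_map phi t.
Proof. exact/tliftD/tensor_map_balanced. Qed.

Lemma tensor_map0 : tensor_map phi (0 : T) = 0.
Proof. exact/tlift0/tensor_map_balanced. Qed.

Lemma tensor_mapZ (z : R[i]) t : (forall w, phi (z *: w) = z *: phi w) ->
  tensor_map phi (z *: t) = z *: tensor_map phi t.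
Proof.
move=> phiZ; apply: balancedZ => [|w f]; first exact: tensor_map_balanced.
by rewrite phiZ scale_tens.
Qed.

End TensorMap.

(** Contractions commute with right B-linear operators on forms and separate the
    points of the tensor product, which transfers identities from forms to forms
    with values in F. *)
Definition contract f (t : T) : Omega := tlift (fun v k => v * incl cal (h k f)) t.

Lemma hermDl f g k : h (f + g) k = h f k + h g k.
Proof. by have := herm_linearl h 1 f g k; rewrite scale1r mul1r. Qed.
Lemma herm0l k : h 0 k = 0.
Proof. by apply: (addIr (h 0 k)); rewrite -hermDl !add0r. Qed.
Lemma hermZl r f k : h (r *: f) k = r * h f k.
Proof. by have := herm_linearl h r f 0 k; rewrite herm0l !addr0. Qed.
Lemma bstar1 : sB 1 = 1.
Proof. by have := bstarM sB (sB 1) 1; rewrite mulr1 bstarK mulr1. Qed.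
Lemma hermDr f g k : h k (f + g) = h k f + h k g.
Proof. by have := herm_linearr h 1 k f g; rewrite scale1r bstar1 mulr1. Qed.
Lemma herm0r k : h k 0 = 0.
Proof. by apply: (addIr (h k 0)); rewrite -hermDr !add0r. Qed.
Lemma hermZr r f k : h k (r *: f) = h k f * sB r.
Proof. by have := herm_linearr h r k f 0; rewrite herm0r !addr0. Qed.

Lemma contract_balanced f : balanced cal (fun v k => v * incl cal (h k f)).
Proof.
split=> [v v' k|v k k'|k|v r k].
- by rewrite mulrDl.
- by rewrite hermDl rmorphD mulrDr.
- by rewrite mul0r.
- by rewrite hermZl rmorphM mulrA.
Qed.

Lemma contract_tens f v k : contract f (tens v k) = v * incl cal (h k f).
Proof. exact/tlift_tens/contract_balanced. Qed.

Lemma contractD f s t : contract f (s + t) = contract f s + contract f t.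
Proof. exact/tliftD/contract_balanced. Qed.

Lemma contract0 f : contract f 0 = 0.
Proof. exact/tlift0/contract_balanced. Qed.

Lemma contractN f t : contract f (- t) = - contract f t.
Proof. by apply: (addrI (contract f t)); rewrite -contractD !subrr contract0. Qed.

Lemma contractZ f (z : R[i]) t : contract f (z *: t) = z *: contract f t.
Proof.
apply: balancedZ => [|w k]; first exact: contract_balanced.
by rewrite scalerAl.
Qed.

Lemma contract_wedge f w t : contract f (wedge w t) = w * contract f t.
Proof.
move: t; apply: tens_ind => [|s t E E'|x g].
- by rewrite wedge0r contract0 mulr0.
- by rewrite wedgeDr !contractD E E' mulrDr.
- by rewrite wedge_tens !contract_tens mulrA.
Qed.

Lemma contract_map phi f t : right_linear phi ->
  contract f (tensor_map phi t) = phi (contract f t).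
Proof.
move=> phiL; have [phiD phiM] := phiL.
move: t; apply: tens_ind => [|s t E E'|x g].
- by rewrite tensor_map0// contract0 right_linear0.
- by rewrite tensor_mapD// !contractD E E' phiD.
- by rewrite tensor_map_tens// !contract_tens phiM.
Qed.

Lemma contractDl f g t : contract (f + g) t = contract f t + contract g t.
Proof.
move: t; apply: tens_ind => [|s t E E'|x k].
- by rewrite !contract0 addr0.
- by rewrite !contractD E E' addrACA.
- by rewrite !contract_tens hermDr rmorphD mulrDr.
Qed.

Lemma contract_scalel r f t : contract (r *: f) t = contract f t * incl cal (sB r).
Proof.
move: t; apply: tens_ind => [|s t E E'|x k].
- by rewrite !contract0 mul0r.
- by rewrite !contractD E E' mulrDl.
- by rewrite !contract_tens hermZr rmorphM mulrA.
Qed.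

(** Since F is a direct summand of a free module and every functional on F is
    h(-, u), there are e_i and u_i in F with f = sum_i h(f, u_i) e_i.  Then t is the
    sum of the contract (u_i) t (x) e_i. *)
Lemma contract_inj0 t : (forall f, contract f t = 0) -> t = 0.
Proof.
have [m [sec [p secK]]] := F_fgp.
have ev_linear i : linear (fun f => sec f ord0 i : B^o).
  by move=> z f g; rewrite linearP !mxE.
pose ev i : {linear F -> B^o} :=
  HB.pack (fun f => sec f ord0 i : B^o) (GRing.isLinear.Build _ _ _ _ _ (ev_linear i)).
have dual i : exists u, forall f, h f u = sec f ord0 i.
  by have [u [uE _]] := herm_bij h (ev i); exists u.
pose u i := projT1 (cid (dual i)).
have uE i f : h f (u i) = sec f ord0 i by exact: (projT2 (cid (dual i))).
pose e i := p (delta_mx ord0 i).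
have expand f : f = \sum_i h f (u i) *: e i.
  rewrite -[LHS]secK [sec f]row_sum_delta linear_sum; apply: eq_bigr => i _.
  by rewrite linearZ_LR uE.
have tE : t = \sum_i tens (contract (u i) t) (e i).
  move: t; apply: tens_ind => [|s t sE tE|w f].
  - by rewrite big1// => i _; rewrite contract0 tens0l.
  - by rewrite {1}sE {1}tE -big_split; apply: eq_bigr => i _; rewrite contractD tensDl.
  - rewrite {1}[f]expand tens_sumr; apply: eq_bigr => i _.
    by rewrite contract_tens tens_inclM.
by move=> t0; rewrite tE big1// => i _; rewrite t0 tens0l.
Qed.

Lemma contract_inj s t : (forall f, contract f s = contract f t) -> s = t.
Proof.
move=> st; apply/eqP; rewrite -subr_eq0; apply/eqP/contract_inj0 => f.
by rewrite contractD contractN st subrr.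
Qed.

(** The pairing of 1 (x) k with t, conjugate linear in t. *)
Definition cocontract k (t : T) : Omega := tlift (fun v f => incl cal (h k f) * sC v) t.

Lemma star_incl w r : sC (w * incl cal r) = incl cal (sB r) * sC w.
Proof.
move: w; apply: (form_ind (cal := cal)) => [|w v E E'|l w lw].
- by rewrite mul0r star0 mulr0.
- by rewrite mulrDl !starD E E' mulrDr.
- by rewrite (fstarM sC lw (incl_form cal _)) muln0 mul1r fstar_incl.
Qed.

Lemma cocontract_balanced k : balanced cal (fun v f => incl cal (h k f) * sC v).
Proof.
split=> [v v' f|v f g|f|v r f].
- by rewrite starD mulrDr.
- by rewrite hermDr rmorphD mulrDl.
- by rewrite star0 mulr0.
- by rewrite star_incl hermZr rmorphM mulrA.
Qed.

Lemma cocontract_tens k v f : cocontract k (tens v f) = incl cal (h k f) * sC v.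
Proof. exact/tlift_tens/cocontract_balanced. Qed.

Lemma cocontractD k s t : cocontract k (s + t) = cocontract k s + cocontract k t.
Proof. exact/tliftD/cocontract_balanced. Qed.

Lemma cocontract0 k : cocontract k 0 = 0.
Proof. exact/tlift0/cocontract_balanced. Qed.

Lemma star1 : sC 1 = 1.
Proof. by rewrite -(rmorph1 (incl cal)) fstar_incl bstar1. Qed.

Lemma cocontractDl k g t : cocontract (k + g) t = cocontract k t + cocontract g t.
Proof.
move: t; apply: tens_ind => [|s t E E'|x f].
- by rewrite !cocontract0 addr0.
- by rewrite !cocontractD E E' addrACA.
- by rewrite !cocontract_tens hermDl rmorphD mulrDl.
Qed.

Lemma cocontract_scalel r k t : cocontract (r *: k) t = incl cal r * cocontract k t.
Proof.
move: t; apply: tens_ind => [|s t E E'|x f].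
- by rewrite !cocontract0 mulr0.
- by rewrite !cocontractD E E' mulrDr.
- by rewrite !cocontract_tens hermZl rmorphM mulrA.
Qed.

Lemma herm_extE s t : herm_ext sC h s t = tlift (fun w f => w * cocontract f t) s.
Proof.
rewrite /herm_ext {1 2}/tlift; apply: eq_bigr => -[w f] _ /=.
by rewrite /cocontract /tlift mulr_sumr; apply: eq_bigr => p _; rewrite mulrA.
Qed.

Lemma herm_ext_contract s k : herm_ext sC h s (tens 1 k) = contract k s.
Proof.
rewrite herm_extE; apply: eq_bigr => -[w f] _ /=.
by rewrite cocontract_tens star1 mulr1.
Qed.

Lemma herm_ext_cocontract k t : herm_ext sC h (tens 1 k) t = cocontract k t.
Proof.
rewrite herm_extE tlift_tens ?mul1r//; split=> [w v f|w f g|f|w r f].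
- by rewrite mulrDl.
- by rewrite cocontractDl mulrDr.
- by rewrite mul0r.
- by rewrite cocontract_scalel mulrA.
Qed.

Variable st : {scalar B}.

Lemma metric0r w : metric K w 0 = 0.
Proof. by apply: (addIr (metric K w 0)); rewrite -metricDr// !add0r. Qed.

Lemma metric0l w : metric K 0 w = 0.
Proof. by apply: (addIr (metric K 0 w)); rewrite -metricDl// !add0r. Qed.

(** The metric satisfies g(w b, v) = g(w, v b^* ) for b in the algebra, so the
    coefficient h(f, k) can be moved to the second argument. *)
Lemma metric_tensorE s t :
  metric_tensor K h s t = tlift (fun w f => metric K w (contract f t)) s.
Proof.
rewrite /metric_tensor {1 3}/tlift; apply: eq_bigr => -[w f] _ /=.
rewrite /contract /tlift (big_morph (metric K w) (metricDr cal_degree K w) (metric0r w)).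
by apply: eq_bigr => p _; rewrite metric_inclA// -herm_sym.
Qed.

Lemma metric_contract_balanced t : balanced cal (fun w f => metric K w (contract f t)).
Proof.
split=> [w v f|w f g|f|w r f].
- exact: metricDl.
- by rewrite contractDl metricDr.
- exact: metric0l.
- by rewrite metric_inclA// contract_scalel.
Qed.

Lemma inner_tens w f t : inner K st h (tens w f) t = st (metric K w (contract f t)).
Proof.
by rewrite /inner metric_tensorE tlift_tens//; exact: metric_contract_balanced.
Qed.

Lemma innerDl s s' t : inner K st h (s + s') t = inner K st h s t + inner K st h s' t.
Proof.
by rewrite /inner !metric_tensorE tliftD ?linearD//; exact: metric_contract_balanced.
Qed.

Lemma inner0l t : inner K st h 0 t = 0.
Proof.
by rewrite /inner !metric_tensorE tlift0 ?linear0//; exact: metric_contract_balanced.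
Qed.

Lemma inner0r s : inner K st h s 0 = 0.
Proof.
move: s; apply: tens_ind => [|s s' E E'|w f]; first exact: inner0l.
- by rewrite innerDl E E' addr0.
- by rewrite inner_tens contract0 metric0r linear0.
Qed.

Hypothesis st_state : is_state sB st.
Hypothesis K_pos : positive_definite K.
Hypothesis K_closed : closed_integral K st.

Lemma inner_nondegenerate t t' :
  (forall s, inner K st h s t = inner K st h s t') -> t = t'.
Proof.
move=> stt'; apply: contract_inj => f; apply/eqP; rewrite -subr_eq0; apply/eqP.
apply: (integral_nondegenerate cal_degree st_state K_pos) => w.
rewrite -metric_integral// metricDr// linearD /= -inner_tens stt' inner_tens.
by rewrite -linearD -metricDr// subrr metric0r linear0.
Qed.

(** An adjoint is unique because the inner product is nondegenerate. *)
Lemma adjointE (E A : T -> T) : linear A ->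
  (forall s t, inner K st h (E s) t = inner K st h s (A t)) ->
  forall t, adjoint K st h E t = A t.
Proof.
move=> linA EA t; have [_ adjE] := xgetPex (fun=> 0)
  (ex_intro (fun A' : T -> T => linear A' /\
     forall s t, inner K st h (E s) t = inner K st h s (A' t)) A (conj linA EA)).
by apply: inner_nondegenerate => s; rewrite -EA; apply/esym/adjE.
Qed.

(** * Extended connections *)

Section Extension.
Variables (D : {linear Omega -> Omega}) (nab : F -> T).
Hypothesis DM : forall w v, D (w * v) = D w * v + parity cal w * D v.
Hypothesis nabD : forall f g, nab (f + g) = nab f + nab g.
Hypothesis nabM : forall r f,
  nab (r *: f) = tens (D (incl cal r)) f + wedge (incl cal r) (nab f).

Lemma extension_balanced :
  balanced cal (fun w f => tens (D w) f + wedge (parity cal w) (nab f)).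
Proof.
split=> [w v f|w f g|f|w r f].
- by rewrite linearD parityD tensDl wedgeDl addrACA.
- by rewrite nabD tensDr wedgeDr addrACA.
- by rewrite linear0 parity0 tens0l wedge0l addr0.
- rewrite DM parityM parity_incl// tensDl nabM wedgeDr wedgeA wedge_tens.
  by rewrite tens_inclM addrA.
Qed.

Lemma extension_tens w f :
  extension D nab (tens w f) = tens (D w) f + wedge (parity cal w) (nab f).
Proof. exact/tlift_tens/extension_balanced. Qed.

Lemma extensionD s t : extension D nab (s + t) = extension D nab s + extension D nab t.
Proof. exact/tliftD/extension_balanced. Qed.

Lemma extension0 : extension D nab (0 : T) = 0.
Proof. exact/tlift0/extension_balanced. Qed.

Lemma extensionZ (z : R[i]) t : extension D nab (z *: t) = z *: extension D nab t.
Proof.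
apply: balancedZ => [|w f]; first exact: extension_balanced.
by rewrite linearZ_LR /= parityZ wedgeZ -scale_tens scalerDr.
Qed.

Lemma extension_linear : linear (extension D nab).
Proof. by move=> z s t; rewrite extensionD extensionZ. Qed.

Lemma extension_wedge w t : extension D nab (wedge w t) =
  wedge (D w) t + wedge (parity cal w) (extension D nab t).
Proof.
move: t; apply: tens_ind => [|s t E E'|v f].
- by rewrite !wedge0r extension0 wedge0r addr0.
- by rewrite !(wedgeDr, extensionD) E E' addrACA.
- rewrite wedge_tens !extension_tens DM parityM wedgeDr !wedge_tens wedgeA.
  by rewrite tensDl addrA.
Qed.

Lemma extension_sqr : (forall w, D (D w) = 0) ->
  (forall w, D (parity cal w) = - parity cal (D w)) ->
  (forall f, extension D nab (nab f) = 0) ->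
  forall t, extension D nab (extension D nab t) = 0.
Proof.
move=> D2 Dp flat t; move: t; apply: tens_ind => [|s t E E'|w f].
- by rewrite !extension0.
- by rewrite !extensionD E E' addr0.
- rewrite extension_tens extensionD extension_tens D2 tens0l add0r extension_wedge flat.
  rewrite wedge0r addr0 Dp -wedgeDl subrr; exact: wedge0l.
Qed.

End Extension.

Lemma right_linear_hodge : right_linear (hodge K).
Proof. by split=> [w v|w r]; [exact: hodgeD|exact: hodge_incl]. Qed.

Lemma right_linear_dual : right_linear (dual_lefschetz K).
Proof. by split=> [w v|w r]; [exact: dual_lefschetzD|exact: dual_lefschetz_incl]. Qed.

Lemma right_linear_parity : right_linear (parity cal).
Proof. by split=> [w v|w r]; rewrite ?parityD// parityM parity_incl. Qed.

Local Notation hodgeF := (tensor_map (hodge K) : T -> T).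
Local Notation parityF := (tensor_map (parity cal) : T -> T).

Lemma hodgeF_hodgeF t : hodgeF (hodgeF t) = parityF t.
Proof.
apply: contract_inj => f; rewrite !contract_map ?hodgeK//;
  by [exact: right_linear_hodge|exact: right_linear_parity].
Qed.

Lemma parityFK t : parityF (parityF t) = t.
Proof.
apply: contract_inj => f; rewrite !contract_map ?parityK//; exact: right_linear_parity.
Qed.

Lemma parityF_span (l : nat) (A : set Omega) t : (forall w, A w -> form cal l w) ->
  tensor_span A t -> parityF t = (-1) ^+ l *: t.
Proof.
move=> Ak [q qA ->].
have PD := tensor_mapD right_linear_parity; have P0 := tensor_map0 right_linear_parity.
rewrite (big_morph _ PD P0) scaler_sumr big_seq [RHS]big_seq; apply: eq_bigr => p pq.
rewrite tensor_map_tens; last exact: right_linear_parity.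
rewrite scale_tens (parity_form (Ak _ (qA _ pq))) -signr_odd -[in RHS]signr_odd.
by case: odd; rewrite ?scaleN1r ?scale1r ?mulN1r ?mul1r.
Qed.

Lemma parityF_wedge w t : parityF (wedge w t) = wedge (parity cal w) (parityF t).
Proof.
have PL := right_linear_parity.
move: t; apply: tens_ind => [|s t E E'|v f].
- by rewrite tensor_map0// !wedge0r tensor_map0.
- by rewrite tensor_mapD// !wedgeDr tensor_mapD// E E'.
- by rewrite wedge_tens !tensor_map_tens// wedge_tens parityM.
Qed.

(** The last clause is the part of bidegree (d1, d2) of the compatibility of the
    connection with h.  The definition is used twice, for (D, nab, D', nab') and for
    the pair exchanged. *)
Definition chern_pair d1 d2 (D D' : {linear Omega -> Omega}) (nab nab' : F -> T) :=
  [/\ dolbeault K d1 d2 D D',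
      forall f g, nab (f + g) = nab f + nab g,
      forall r f, nab (r *: f) = tens (D (incl cal r)) f + wedge (incl cal r) (nab f),
      forall f, tensor_span (bform K d1 d2) (nab f)
    & forall k f, D (incl cal (h k f)) = contract f (nab k) + cocontract k (nab' f)].

(** * Adjoints and Kaehler identities for a pair of conjugate connections *)

Section ChernPair.
Variables (d1 d2 : nat) (D D' : {linear Omega -> Omega}) (nab nab' : F -> T).
Hypothesis cp : chern_pair d1 d2 D D' nab nab'.
Hypothesis cp' : chern_pair d2 d1 D' D nab' nab.

Local Notation E := (extension D nab).
Local Notation E' := (extension D' nab').

Let dD : dolbeault K d1 d2 D D'. Proof. by have [] := cp. Qed.
Let dD' : dolbeault K d2 d1 D' D. Proof. by have [] := cp'. Qed.
Let DM := dolbeaultM dD.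
Let D'M := dolbeaultM dD'.
Let nabD f g : nab (f + g) = nab f + nab g. Proof. by have [] := cp. Qed.
Let nab'D f g : nab' (f + g) = nab' f + nab' g. Proof. by have [] := cp'. Qed.
Let nabM r f : nab (r *: f) = tens (D (incl cal r)) f + wedge (incl cal r) (nab f).
Proof. by have [] := cp. Qed.
Let nab'M r f : nab' (r *: f) = tens (D' (incl cal r)) f + wedge (incl cal r) (nab' f).
Proof. by have [] := cp'. Qed.
Let d12 : (d1 + d2 = 1)%N. Proof. by have [] := dD. Qed.

Lemma cocontract_sum k (q : seq (Omega * F)) :
  cocontract k (\sum_(p <- q) tens p.1 p.2) = \sum_(p <- q) incl cal (h k p.2) * sC p.1.
Proof.
rewrite (big_morph _ (cocontractD k) (cocontract0 k)); apply: eq_bigr => p _.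
exact: cocontract_tens.
Qed.

(** Through the Hermitian pairing E becomes D, corrected by multiplications by the
    conjugates of the 1-forms p.1 that occur in nab' f.  This is the compatibility
    of the connections with h, extended to forms by the Leibniz rule. *)
Lemma contract_extension f (q : seq (Omega * F)) t :
  nab' f = \sum_(p <- q) tens p.1 p.2 ->
  contract f (E t) =
  D (contract f t) - \sum_(p <- q) rmul_parity cal (sC p.1) (contract p.2 t).
Proof.
move=> fE; move: t; apply: tens_ind => [|s t sE tE|v k].
- rewrite extension0// contract0 linear0 sub0r big1 ?oppr0// => p _.
  by rewrite contract0 /rmul_parity parity0 mul0r.
- rewrite extensionD// !contractD linearD sE tE addrACA -opprD -big_split.
  congr (_ + _ - _); apply: eq_bigr => p _.
  by rewrite contractD /rmul_parity parityD mulrDl.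
rewrite extension_tens// contractD contract_wedge !contract_tens DM.
have [_ _ _ _ ->] := cp; rewrite mulrDr -!addrA; congr (_ + _).
rewrite fE cocontract_sum -[LHS]addr0; congr (_ + _).
apply/esym/eqP; rewrite subr_eq0; apply/eqP. rewrite mulr_sumr; apply: eq_bigr => p _.
by rewrite contract_tens /rmul_parity parityM parity_incl mulrA.
Qed.

(** After contraction, E is a sum of D and of multiplications by 1-forms;
    all these operators have bidegree (d1, d2) and commute with L, so
    local_kahler_identity applies to each of them. *)
Lemma extension_kahler t : LambdaF K (E t) - E (LambdaF K t) =
  - (phase R[i] d1 d2 *: hodgeF (E (hodgeF t))).
Proof.
apply: contract_inj => f.
have [q qb fE] : tensor_span (bform K d2 d1) (nab' f) by have [] := cp'.
have HL := right_linear_hodge; have LL := right_linear_dual.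
rewrite contractD !contractN contractZ !contract_map// !(contract_extension _ fE).
rewrite !contract_map//.
move: (contract f t) => c.
rewrite dual_lefschetzB// dual_lefschetz_sum// hodgeB// hodge_sum//.
rewrite scalerBr [in RHS]opprB [RHS]addrC opprB [X in _ + X = _]addrC addrACA.
rewrite (local_kahler_identity cal_degree (K := K) d12 (D := D)); last 2 first.
- by have [] := dD.
- move=> w; rewrite DM (dolbeault_closed dD (kappa11 K) (kappa_closed K)) mul0r add0r.
  by rewrite (parity_bform (kappa11 K)) addn1 sqrrN expr1n mul1r.
congr (_ + _); rewrite scaler_sumr addrC -sumrB big_seq [RHS]big_seq.
apply: eq_bigr => p /qb pb.
rewrite -[RHS]opprK; apply: (canRL (@opprK _)); rewrite opprB.
rewrite /LambdaF !contract_map//.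
apply: (local_kahler_identity cal_degree d12 (D := rmul_parity_fun cal (sC p.1))).
- by apply: rmul_parity_bidegree; exact: bform_starr.
- move=> w /=; rewrite /rmul_parity parityM (parity_bform (kappa11 K)) addn1 sqrrN expr1n mul1r.
  by rewrite mulrA.
Qed.

(** On w (x) f both sides are integrals over forms: D' w contributes by Stokes, and
    the 1-forms in nab' f are moved to the other side one at a time. *)
Lemma extension_adjoint s t :
  inner K st h (E' s) t = inner K st h s (- hodgeF (E (hodgeF t))).
Proof.
move: s; apply: tens_ind => [|s s' sE s'E|w f].
- by rewrite extension0// !inner0l.
- by rewrite extensionD// !innerDl sE s'E.
have [q qb fE] : tensor_span (bform K d2 d1) (nab' f) by have [] := cp'.
have HL := right_linear_hodge.
rewrite extension_tens// innerDl !inner_tens contractN contract_map//.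
rewrite (contract_extension _ fE) contract_map// -hodgeN// opprB !metric_integral//.
move: (contract f t) => c; rewrite hodgeB// hodge_sum// integral_pairingB//.
rewrite integral_pairing_sum// addrC.
congr (_ + _); last exact: (integral_adjoint cal_degree K_closed _ _ dD).
rewrite fE (big_morph _ (wedgeDr _) (wedge0r _)).
rewrite (big_morph (fun s => inner K st h s t) (fun s s' => innerDl s s' t) (inner0l t)).
rewrite big_seq [RHS]big_seq; apply: eq_bigr => p /qb pb.
rewrite wedge_tens inner_tens metric_integral// contract_map//.
apply: integral_adjoint_rmul => //; have := bform_form pb.
by rewrite addnC d12.
Qed.

Lemma hodge_extension_linear : linear (fun t => - hodgeF (E (hodgeF t))).
Proof.
have HL := right_linear_hodge.
have SZ (c : R[i]) u : hodgeF (c *: u) = c *: hodgeF u.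
  by apply: tensor_mapZ => // w; exact: hodgeZ.
move=> z s t.
by rewrite !tensor_mapD// !SZ extensionD// extensionZ// tensor_mapD// SZ opprD scalerN.
Qed.

Lemma adjoint_extension t : adjoint K st h E' t = - hodgeF (E (hodgeF t)).
Proof.
apply: (adjointE (A := fun t => - hodgeF (E (hodgeF t)))) => [|s s'].
  exact: hodge_extension_linear.
exact: extension_adjoint.
Qed.

Lemma adjoint_linear : linear (adjoint K st h E').
Proof. by move=> z s t; rewrite !adjoint_extension; exact: hodge_extension_linear. Qed.

Lemma adjoint_extensionE t :
  adjoint K st h E' t = - phase R[i] d1 d2 *: (LambdaF K (E t) - E (LambdaF K t)).
Proof.
rewrite extension_kahler adjoint_extension scalerN scaleNr opprK scalerA phase_sqr d12.
by rewrite expr1 scaleN1r.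
Qed.

Hypothesis flat' : forall f, E' (nab' f) = 0.

Lemma flat_extension_sqr t : E' (E' t) = 0.
Proof.
by apply: extension_sqr => //; [exact: dolbeault_sqr dD'|exact: dolbeault_parity dD'].
Qed.

(** Both D and nab raise the degree by one. *)
Lemma extension_parityF t : E (parityF t) = - parityF (E t).
Proof.
have PL := right_linear_parity.
move: t; apply: tens_ind => [|s t sE tE|w f].
- by rewrite tensor_map0// extension0// tensor_map0// oppr0.
- by rewrite tensor_mapD// !extensionD// tensor_mapD// sE tE opprD.
rewrite tensor_map_tens// !extension_tens// tensor_mapD// tensor_map_tens// parityF_wedge.
have -> : parityF (nab f) = - nab f.
  rewrite (@parityF_span 1 (bform K d1 d2)) ?expr1 ?scaleN1r//.
    by move=> v /bform_form; rewrite d12.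
  by have [] := cp.
by rewrite (dolbeault_parity dD) opprD tensNl wedgeNr opprK.
Qed.

(** The adjoint of an operator of square zero has square zero. *)
Lemma adjoint_extension_sqr t : adjoint K st h E' (adjoint K st h E' t) = 0.
Proof.
apply: inner_nondegenerate => s; rewrite !adjoint_extension -!extension_adjoint.
by rewrite flat_extension_sqr inner0l inner0r.
Qed.

(** By adjoint_extension the adjoint of E' is E conjugated by the Hodge map up to
    sign, so E has square zero as well. *)
Lemma conjugate_extension_sqr t : E (E t) = 0.
Proof.
have HL := right_linear_hodge; have PL := right_linear_parity.
have SN s : hodgeF (- s) = - hodgeF s.
  by apply: (addrI (hodgeF s)); rewrite -tensor_mapD// !subrr tensor_map0.
have EN s : E (- s) = - E s.
  by apply: (addrI (E s)); rewrite -extensionD// !subrr extension0.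
(* The argument is chosen such that the innermost Hodge map sends it to t. *)
have := adjoint_extension_sqr (hodgeF (parityF t)).
rewrite !adjoint_extension SN EN SN opprK !hodgeF_hodgeF parityFK extension_parityF SN => /eqP.
rewrite oppr_eq0 => /eqP /(congr1 (fun s => hodgeF s)).
by rewrite hodgeF_hodgeF parityFK tensor_map0.
Qed.

End ChernPair.

(** * The Chern connection *)

Section ChernConnection.
Variables (hol : holomorphic_structure K F) (nab : F -> T).
Hypothesis nab_chern : is_chern_connection h hol nab.

Local Notation bgrade := (fun p : nat * nat => bform K p.1 p.2).
Local Notation bpart p := (component bgrade p).

Let delnab f := bidegree_part K 1 0 (nab f).

Lemma right_linear_bpart p : right_linear (bpart p).
Proof.
case: p => a b; split=> [w v|w r]; first exact: (componentD (bform_direct K)).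
move: w; apply: (bform_ind (cs := K)) => [|w v E E'|c e w cew].
- by rewrite mul0r (component0 (bform_direct K)) mul0r.
- by rewrite mulrDl !(componentD (bform_direct K)) E E' mulrDl.
have := bform_mul cew (incl_bform K r); rewrite !addn0 => cewr.
by rewrite (bpart_bform _ _ cew) (bpart_bform _ _ cewr); case: ifP; rewrite ?mul0r.
Qed.

Lemma bpart_incl a b r w : bpart (a, b) (incl cal r * w) = incl cal r * bpart (a, b) w.
Proof.
have bid : bidegree K 0 0 (lmul_fun (incl cal r)).
  by move=> c e v cev; rewrite !addn0; exact: bform_mul (incl_bform K r) cev.
by have := bpart_bidegree bid a b w; rewrite !addn0.
Qed.

Lemma bpart_star a b w : bpart (a, b) (sC w) = sC (bpart (b, a) w).
Proof.
move: w; apply: (bform_ind (cs := K)) => [|w v E E'|c e w cew].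
- by rewrite star0 !(component0 (bform_direct K)) star0.
- by rewrite starD !(componentD (bform_direct K)) E E' starD.
rewrite (bpart_bform _ _ cew) (bpart_bform _ _ (bform_starr cew)) andbC.
by case: ifP; rewrite ?star0.
Qed.

(** Conjugation exchanges the two indices of the bidegree. *)
Lemma cocontract_bidegree a b k t :
  bpart (a, b) (cocontract k t) = cocontract k (bidegree_part K b a t).
Proof.
have PL := right_linear_bpart.
move: t; apply: tens_ind => [|s t sE tE|w f].
- by rewrite /bidegree_part tensor_map0// cocontract0 (component0 (bform_direct K)).
- rewrite /bidegree_part tensor_mapD// !cocontractD (componentD (bform_direct K)).
  by rewrite sE tE.
- by rewrite /bidegree_part tensor_map_tens// !cocontract_tens bpart_incl bpart_star.
Qed.

Lemma bidegree_partD a b s t :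
  bidegree_part K a b (s + t) = bidegree_part K a b s + bidegree_part K a b t.
Proof. exact: tensor_mapD (right_linear_bpart _) _ _. Qed.

Lemma bidegree_part_wedge a b r t :
  bidegree_part K a b (wedge (incl cal r) t) = wedge (incl cal r) (bidegree_part K a b t).
Proof.
have PL := right_linear_bpart; rewrite /bidegree_part.
move: t; apply: tens_ind => [|s t sE tE|w f].
- by rewrite wedge0r tensor_map0// wedge0r.
- by rewrite wedgeDr !tensor_mapD// sE tE wedgeDr.
- by rewrite wedge_tens !tensor_map_tens// wedge_tens bpart_incl.
Qed.

Lemma nab_split f : nab f = delnab f + hol f.
Proof.
have [[_ /(_ f)[q q1 fE] _] _ <-] := nab_chern.
have PL := right_linear_bpart; rewrite /delnab /bidegree_part fE.
rewrite !(big_morph _ (tensor_mapD (PL _)) (tensor_map0 (PL _))) -big_split.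
rewrite big_seq [RHS]big_seq; apply: eq_bigr => p /q1 /= p1.
rewrite !tensor_map_tens// -tensDl; congr tens; move: p1; move: (p.1).
apply: (form_bform_ind (cs := K)) => [|w v wE vE|a b w ab abw].
- by rewrite !(component0 (bform_direct K)) addr0.
- by rewrite !(componentD (bform_direct K)) {1}wE {1}vE addrACA.
rewrite !(bpart_bform _ _ abw).
have [[-> ->]|[-> ->]] : (a = 1 /\ b = 0)%N \/ (a = 0 /\ b = 1)%N by lia.
  by rewrite /= addr0.
by rewrite /= add0r.
Qed.

Lemma tensor_span_bidegree a b t : tensor_span (bform K a b) (bidegree_part K a b t).
Proof.
have PL := right_linear_bpart (a, b); rewrite /bidegree_part.
move: t; apply: tens_ind => [|s t [p pb pE] [q qb qE]|w f].
- by exists [::]; rewrite ?big_nil ?tensor_map0.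
- exists (p ++ q); last by rewrite tensor_mapD// big_cat pE qE.
  by move=> x; rewrite mem_cat => /orP[/pb|/qb].
- exists [:: (bpart (a, b) w, f)]; last by rewrite big_seq1 tensor_map_tens.
  by move=> x; rewrite inE => /eqP -> /=; exact: bpart_grade.
Qed.

Lemma connection_additive (D : Omega -> Omega) (A : set Omega) (nab0 : F -> T) f g :
  is_connection D A nab0 -> nab0 (f + g) = nab0 f + nab0 g.
Proof. by move=> [/(_ 1 f g) + _ _]; rewrite !scale1r. Qed.

(** The compatibility is the part of bidegree (1, 0) of the equation that defines
    the Chern connection: conjugation turns the part of bidegree (0, 1) of the
    second term into the bidegree (1, 0). *)
Lemma chern_pair_del : chern_pair 1 0 (del K) (delbar K) delnab hol.
Proof.
have dd := dolbeault_del K; have [conn hermE holE] := nab_chern.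
split=> //.
- move=> f g; rewrite /delnab (connection_additive _ _ conn) /bidegree_part tensor_mapD//.
  exact: right_linear_bpart.
- move=> r f; have [_ _ connM] := conn.
  rewrite /delnab connM bidegree_partD bidegree_part_wedge; congr (_ + _).
  rewrite /bidegree_part tensor_map_tens; last exact: right_linear_bpart.
  by rewrite -[in RHS](bpart_dolbeault dd (incl_bform K r)).
- by move=> f; exact: tensor_span_bidegree.
move=> k f; rewrite -(bpart_dolbeault dd (incl_bform K _)) hermE.
rewrite (componentD (bform_direct K)) herm_ext_contract herm_ext_cocontract.
rewrite cocontract_bidegree holE; congr (_ + _).
by rewrite /delnab /bidegree_part contract_map//; exact: right_linear_bpart.
Qed.

Lemma chern_pair_delbar : chern_pair 0 1 (delbar K) (del K) hol delnab.
Proof.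
have dd := dolbeault_sym (dolbeault_del K); have [conn hermE holE] := nab_chern.
have [] := dbar_connection hol => ? holspan holM.
split=> //.
- by move=> f g; apply: connection_additive (dbar_connection hol).
move=> k f; rewrite -(bpart_dolbeault dd (incl_bform K _)) hermE.
rewrite (componentD (bform_direct K)) herm_ext_contract herm_ext_cocontract.
rewrite cocontract_bidegree; congr (_ + _).
by rewrite -holE /bidegree_part contract_map//; exact: right_linear_bpart.
Qed.

Let cpd := chern_pair_del.
Let cpb := chern_pair_delbar.

Local Notation E := (delF K nab).
Local Notation E' := (delbarF hol).

Lemma delbarF_sqr t : E' (E' t) = 0.
Proof. exact: (flat_extension_sqr cpb (dbar_flat hol)). Qed.

Lemma delF_sqr t : E (E t) = 0.
Proof. exact: (conjugate_extension_sqr cpd cpb (dbar_flat hol)). Qed.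

(** The section f is the form 1 (x) f of degree 0, and its image under delF is
    delnab f. *)
Lemma delF_flat f : E (delnab f) = 0.
Proof.
have [dd delnabD delnabM _ _] := cpd.
have <- : E (tens 1 f) = delnab f; last exact: delF_sqr.
rewrite /delF (extension_tens (dolbeaultM dd) delnabD delnabM).
have := dolbeaultM dd 1 1; have p1 : parity cal 1 = 1.
  by rewrite -(rmorph1 (incl cal)) parity_incl.
rewrite p1 !mul1r mulr1 => /eqP; rewrite -subr_eq0 opprD addrA subrr sub0r oppr_eq0.
move=> /eqP ->; rewrite tens0l add0r.
move: (delnab f) => t; move: t; apply: tens_ind => [|s t sE tE|w g].
- exact: wedge0r.
- by rewrite wedgeDr sE tE.
- by rewrite wedge_tens mul1r.
Qed.

Lemma nablaF_split t : nablaF nab t = E t + E' t.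
Proof.
have [dd delnabD delnabM _ _] := cpd; have [dd' holD holM _ _] := cpb.
have [conn _ _] := nab_chern; have [_ _ connM] := conn.
have difM w v : dif cal (w * v) = dif cal w * v + parity cal w * dif cal v.
  by rewrite !(difE K) (dolbeaultM dd) (dolbeaultM dd') mulrDl mulrDr addrACA.
have connD f g : nab (f + g) = nab f + nab g by exact: connection_additive conn.
have D0 := extension_tens difM connD connM.
have D1 := extension_tens (dolbeaultM dd) delnabD delnabM.
have D2 := extension_tens (dolbeaultM dd') holD holM.
have A0 := extensionD difM connD connM.
have A1 := extensionD (dolbeaultM dd) delnabD delnabM.
have A2 := extensionD (dolbeaultM dd') holD holM.
rewrite /nablaF /delF /delbarF; move: t; apply: tens_ind => [|s t sE tE|w f].
- rewrite (extension0 difM connD connM) (extension0 (dolbeaultM dd) delnabD delnabM).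
  by rewrite (extension0 (dolbeaultM dd') holD holM) addr0.
- by rewrite A0 A1 A2 sE tE addrACA.
by rewrite D0 D1 D2 (difE K) tensDl {1}nab_split wedgeDr addrACA.
Qed.

Lemma delF_linear : linear E.
Proof. by have [dd nD nM _ _] := cpd; exact: extension_linear (dolbeaultM dd) nD nM. Qed.

Lemma delbarF_linear : linear E'.
Proof. by have [dd nD nM _ _] := cpb; exact: extension_linear (dolbeaultM dd) nD nM. Qed.

Lemma LambdaF_linear : linear (LambdaF K (F := F)).
Proof.
have LL := right_linear_dual.
move=> z s t; rewrite /LambdaF tensor_mapD// tensor_mapZ// => w.
exact: dual_lefschetzZ.
Qed.

Local Notation A := (delF_adj K st h nab).
Local Notation A' := (delbarF_adj st h hol).

Lemma delF_adjE t : A t = 'i *: (LambdaF K (E' t) - E' (LambdaF K t)).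
Proof.
by rewrite /delF_adj (adjoint_extensionE cpb cpd) /phase expr0 expr1 mul1r opprK.
Qed.

Lemma delbarF_adjE t : A' t = - 'i *: (LambdaF K (E t) - E (LambdaF K t)).
Proof.
by rewrite /delbarF_adj (adjoint_extensionE cpd cpb) /phase expr0 expr1 mulr1.
Qed.

Let linear_pack (f : T -> T) (fL : linear f) : {linear T -> T} :=
  HB.pack f (GRing.isLinear.Build _ _ _ _ _ fL).

Lemma chern_laplacians t :
  let Br := commutator (LambdaF K (F := F)) (i_curvature nab) t in
  [/\ laplacian_nabla st h hol nab t =
        laplacian_del K st h nab t + laplacian_delbar st h hol t,
      laplacian_nabla st h hol nab t = 2 *: laplacian_del K st h nab t - Br
    & laplacian_nabla st h hol nab t = 2 *: laplacian_delbar st h hol t + Br].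
Proof.
have A_linear : linear A := adjoint_linear cpb cpd.
have A'_linear : linear A' := adjoint_linear cpd cpb.
have := @nakano_identity _ _ (linear_pack delF_linear) (linear_pack delbarF_linear)
  (linear_pack LambdaF_linear) (linear_pack A_linear) (linear_pack A'_linear)
  delF_sqr delbarF_sqr delF_adjE delbarF_adjE
  (adjoint_extension_sqr cpb cpd delF_flat)
  (adjoint_extension_sqr cpd cpb (dbar_flat hol)) t.
by rewrite /laplacian_nabla /commutator /i_curvature !nablaF_split.
Qed.

End ChernConnection.

End Tensor.

Theorem proposition3p1 (R : realType) (B Omega : algType R[i])
    (sB : star_algebra B) (cal : calculus B Omega)
    (sC : star_calculus sB cal) (n : nat)
    (cal_degree : total_degree cal n.*2)
    (K : kahler_structure n sC) (K_pos : positive_definite K)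
    (st : {scalar B}) (st_state : is_state sB st)
    (K_closed : closed_integral K st)
    (F : lmodType B) (F_fgp : fg_projective F)
    (h : hermitian_structure sB F) (hol : holomorphic_structure K F)
    (nab : F -> tensor cal F) (nab_chern : is_chern_connection h hol nab)
    (t : tensor cal F) :
  let Delta_nabla := laplacian_nabla st h hol nab in
  let Delta_del := laplacian_del K st h nab in
  let Delta_delbar := laplacian_delbar st h hol in
  let Lambda_icurv := commutator (LambdaF K (F := F)) (i_curvature nab) in
  [/\ Delta_nabla t = Delta_del t + Delta_delbar t,
      Delta_nabla t = 2 *: Delta_del t - Lambda_icurv t
    & Delta_nabla t = 2 *: Delta_delbar t + Lambda_icurv t].
Proof. exact: chern_laplacians. Qed.
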